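(* Let $F$ be a fixed graph on $f$ vertices with $\chi(F)=r+1\geq 2$. For every $\varepsilon>0$ there exists $\delta>0$ such that the following holds. Let $(G_m)$ be a sequence of graphs with $e(G_m)=m$ and $N_F(G_m)=o(m^{f/2})$ as $m\to\infty$. Then for all sufficiently large $m$, writing $G=G_m$: (i) If $r\geq 3$ and $\rho(G)\geq\sqrt{(1-\frac{1}{r}-\delta)2m}$, then there exist an integer $n$ and a Tur\'{a}n graph $T_{n,r}$ with $V(T_{n,r})\subseteq V(G)$ and $d(G,T_{n,r})\leq \varepsilon m$. (ii) If $r=2$ and $\rho(G)\geq\sqrt{(1-\delta)m}$, or if $r=1$, $\beta'(F)\geq 2$ and $\rho(G)\geq\sqrt{(1-\delta)m}$, then there exist two disjoint subsets $U,V\subseteq V(G)$ with $d(G,K_{U,V})\leq \varepsilon m$.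
   Context: All graphs are finite and simple. $\rho(G)$ is the spectral radius of the adjacency matrix of $G$; $N_F(G)$ is the number of (not necessarily induced) subgraphs of $G$ isomorphic to $F$. $T_{n,r}$ is the Tur\'{a}n graph: the complete $r$-partite graph on $n$ vertices with part sizes as equal as possible. For disjoint vertex sets $U,V$, $K_{U,V}$ is the complete bipartite graph with parts $U$ and $V$. For two graphs $G,H$ (possibly on different vertex sets), $d(G,H):=|E(G)\setminus E(H)|+|E(H)\setminus E(G)|$. $\beta'(F)$ is the minimum cardinality of an independent covering of $F$ (a set of pairwise nonadjacent vertices meeting every edge). *)

(* Defs.v *)
From HB Require Import structures.
From mathcomp Require Import all_boot all_order all_algebra.
From mathcomp Require Import all_classical all_reals all_analysis.
From mathcomp Require Import complex.

Set Implicit Arguments.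
Unset Strict Implicit.
Unset Printing Implicit Defensive.

Import Order.TTheory GRing.Theory Num.Theory.
Import numFieldNormedType.Exports.

Local Open Scope ring_scope.

Record sgraph := SGraph {
  svertex :> finType;
  adj : rel svertex;
  adj_sym : symmetric adj;
  adj_irr : irreflexive adj }.

(* A graph whose vertex set is a subset of an ambient finite type V: the pair
   of its vertex set and its edge set (edges are 2-element sets). *)
Definition graph_in (V : finType) : Type := ({set V} * {set {set V}})%type.

Definition edges (G : sgraph) : {set {set G}} :=
  [set [set p.1; p.2] | p : G * G & adj p.1 p.2].

Definition graph_of (G : sgraph) : graph_in G := ([set: G], edges G).

Definition size_graph (G : sgraph) : nat := #|edges G|.

Definition gdist (V : finType) (H1 H2 : graph_in V) : nat :=
  (#|H1.2 :\: H2.2| + #|H2.2 :\: H1.2|)%N.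

Definition is_copy (F : sgraph) (V : finType) (H : graph_in V) : bool :=
  [exists phi : {ffun F -> V},
    [&& injectiveb phi, H.1 == phi @: [set: F]
      & H.2 == [set phi @: e | e : {set F} in edges F]]].

Definition subgraph (V : finType) (H1 H2 : graph_in V) : bool :=
  (H1.1 \subset H2.1) && (H1.2 \subset H2.2).

Definition num_copies (F G : sgraph) : nat :=
  #|[set H : {set G} * {set {set G}} |
      subgraph H (graph_of G) && is_copy F H]|.

Definition colorable (G : sgraph) (k : nat) : bool :=
  [exists c : {ffun G -> 'I_k},
    [forall x, forall y, adj x y ==> (c x != c y)]].

Lemma colorable_card (G : sgraph) : exists k, colorable G k.
Proof.
exists #|G|; apply/existsP; exists [ffun x => enum_rank x].
apply/forallP => x; apply/forallP => y; apply/implyP => xy.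
rewrite !ffunE (inj_eq enum_rank_inj); apply: contraTneq xy => ->.
by rewrite adj_irr.
Qed.

Definition chi (G : sgraph) : nat := ex_minn (colorable_card G).

Definition independent_covering (G : sgraph) (S : {set G}) : bool :=
  [forall x in S, forall y in S, ~~ adj x y] &&
  [forall x, forall y, adj x y ==> (x \in S) || (y \in S)].

(* An independent covering exists iff G is bipartite; otherwise the value is
   the default #|G|. *)
Definition beta' (G : sgraph) : nat :=
  \big[minn/#|G|]_(S : {set G} | independent_covering S) #|S|.

Definition adjmx (R : realType) (G : sgraph) : 'M[R]_#|G| :=
  \matrix_(i, j) (adj (enum_val i) (enum_val j))%:R.

Definition spectral_radius (R : realType) (n : nat) (A : 'M[R]_n) : R :=
  sup [set Normc.normc z | z in
        [set z : R[i] | eigenvalue (map_mx (real_complex R) A) z]]%classic.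

Definition rho (R : realType) (G : sgraph) : R := spectral_radius (adjmx R G).

Definition complete_multipartite (V : finType) (r : nat)
    (P : 'I_r -> {set V}) : graph_in V :=
  (\bigcup_i P i,
   [set [set p.1; p.2] | p : V * V &
     [exists i, exists j, [&& i != j, p.1 \in P i & p.2 \in P j]]]).

(* Parts may be empty, so that T_{n,r} is K_n when n < r. *)
Definition is_turan (n r : nat) (V : finType) (H : graph_in V) : Prop :=
  #|H.1| = n /\
  exists P : 'I_r -> {set V},
    [/\ forall i j, i != j -> [disjoint P i & P j],
        forall i j, (#|P i| <= #|P j|.+1)%N
      & H = complete_multipartite P].

Definition complete_bipartite (V : finType) (A B : {set V}) : graph_in V :=
  (A :|: B, [set [set x; y] | x in A, y in B]).

(* Main.v *)
Require Import Defs.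
From HB Require Import structures.
From mathcomp Require Import all_boot all_order all_algebra.
From mathcomp Require Import ring lra.

(* An eigenvector for an eigenvalue of modulus close to rho gives, by moduli, a unit
   vector x >= 0 with x^T A x close to rho.  Put p = x^2, a probability weight on
   the vertices.  By Cauchy-Schwarz rho^2 <= 2m * sum_{vw in E} p_v p_w, and the
   weighted edge density is at most 1 - 1/r (Motzkin-Straus) up to the weighted
   density of (r+1)-cliques.  So in the near-extremal case x_v x_w is almost
   constant, equal to al = sqrt((1 - 1/r)/(2m)), on almost all edges.  Among
   the edges with x_v x_w of order al, every vertex of a triangle has p_v of order
   m^(-1/2), so few (r+1)-cliques means small weighted density.

   Stability of the density bound: averaging the Moon-Moser inequality over the
   r-cliques S shows that for some S almost every vertex sees all but exactly one
   element of S; these are the classes V_u.  Edges inside V_u extend S \ u to an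
   (r+1)-clique.  For v, w in different classes a path v - u' - u - w pins
   x_v x_w between al/8 and 8 al, which turns weights into edge counts.

   Finally few copies of F force few s-cliques, s = max(r+1, 3): since s >= 3,
   vertices of degree << sqrt m meet few s-cliques, and on the remaining
   O(sqrt m) vertices iterated power means count blow-ups of K_s, hence copies
   of F.  For r = 1 this yields few triangles, so r = 1 reduces to r = 2. *)

Set Implicit Arguments.
Unset Strict Implicit.
Unset Printing Implicit Defensive.

Import Order.TTheory GRing.Theory Num.Theory.

Local Open Scope ring_scope.

(** * Weighted cliques *)

(** Lagrange's identity: the double sum of [w i * w j * (d i - d j) ^+ 2] is twice the difference of
    the two sides. *)
Lemma weighted_cauchy_schwarz (R : realFieldType) (I : finType) (P : pred I)
    (w d : I -> R) : (forall i, P i -> 0 <= w i) ->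
  (\sum_(i | P i) w i * d i) ^+ 2 <=
    (\sum_(i | P i) w i) * (\sum_(i | P i) w i * d i ^+ 2).
Proof.
move=> w0.
have H : 0 <= \sum_(i | P i) \sum_(j | P j) w i * w j * (d i - d j) ^+ 2.
  apply: sumr_ge0 => i Pi; apply: sumr_ge0 => j Pj.
  by rewrite mulr_ge0 ?sqr_ge0 ?mulr_ge0 ?w0.
have E : \sum_(i | P i) \sum_(j | P j) w i * w j * (d i - d j) ^+ 2 =
   (\sum_(i | P i) w i) * (\sum_(i | P i) w i * d i ^+ 2) +
   (\sum_(i | P i) w i * d i ^+ 2) * (\sum_(i | P i) w i) -
   2 * ((\sum_(i | P i) w i * d i) * (\sum_(i | P i) w i * d i)).
  rewrite !big_distrlr /= mulr_sumr -!big_split /= -sumrB.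
  apply: eq_bigr => i Pi; rewrite mulr_sumr -big_split /= -sumrB.
  by apply: eq_bigr => j Pj; ring.
rewrite E in H; nra.
Qed.

Section WeightedCliques.
Variables (R : realFieldType) (V : finType) (p : V -> R).

Definition mass (A : {set V}) : R := \sum_(v in A) p v.
Definition wt (A : {set V}) : R := \prod_(v in A) p v.

Definition clique (e : rel V) (S : {set V}) : bool :=
  [forall x in S, forall y in S, (x != y) ==> e x y].

Definition cnbr (e : rel V) (S : {set V}) : {set V} :=
  [set v | [forall u in S, e v u]].

(** For weights of total 1, [s]! times this is the probability that [s] independent draws from [p]
    form a clique of size [s]. *)
Definition cliquew (e : rel V) (s : nat) : R :=
  \sum_(S : {set V} | clique e S && (#|S| == s)) wt S.

(* For a generic clique S of maximal size these are the colour classes. *)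
Definition cpart (e : rel V) (S : {set V}) (u : V) : {set V} :=
  [set v | [forall w in S, e v w == (w != u)]].

Lemma cliqueP (e : rel V) (S : {set V}) :
  reflect {in S &, forall x y, x != y -> e x y} (clique e S).
Proof.
apply: (iffP forall_inP) => [H x y xS yS xy|H x xS].
  by have /forall_inP/(_ y yS)/implyP/(_ xy) := H x xS.
by apply/forall_inP => y yS; apply/implyP; apply: H.
Qed.

Lemma cnbrP (e : rel V) (S : {set V}) v :
  reflect {in S, forall u, e v u} (v \in cnbr e S).
Proof. by rewrite inE; apply: (iffP forall_inP). Qed.

Lemma cpartP (e : rel V) (S : {set V}) u v :
  reflect {in S, forall w, e v w = (w != u)} (v \in cpart e S u).
Proof. by rewrite inE; apply: (iffP 'forall_in_eqP). Qed.

Lemma cnbr_notin (e : rel V) (S : {set V}) v :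
  irreflexive e -> v \in cnbr e S -> v \notin S.
Proof.
by move=> irr /cnbrP vS; apply/negP => /vS; rewrite irr.
Qed.

Lemma cliqueU1 (e : rel V) (S : {set V}) v : symmetric e -> v \notin S ->
  clique e (v |: S) = clique e S && (v \in cnbr e S).
Proof.
move=> sym vS; apply/cliqueP/andP.
  move=> H; split.
    by apply/cliqueP => x y xS yS; apply: H; rewrite !inE ?xS ?yS orbT.
  apply/cnbrP => u uS; apply: H; rewrite ?inE ?eqxx ?uS ?orbT //.
  by apply: contraNneq vS => ->.
case=> /cliqueP cS /cnbrP vn x y; rewrite !inE.
case/orP => [/eqP->|xS]; case/orP => [/eqP->|yS].
- by rewrite eqxx.
- by move=> _; apply: vn.
- by move=> _; rewrite sym; apply: vn.
- exact: cS.
Qed.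

(** Double counting through the bijection from pairs (clique, one of its vertices) to pairs (smaller
    clique, common neighbour). All clique identities below are instances. *)
Lemma sum_clique_rem (e : rel V) (s : nat) (g : {set V} -> V -> R) :
  symmetric e -> irreflexive e ->
  \sum_(S : {set V} | clique e S && (#|S| == s.+1)) \sum_(u in S) g (S :\ u) u =
  \sum_(U : {set V} | clique e U && (#|U| == s)) \sum_(v in cnbr e U) g U v.
Proof.
move=> sym irr; rewrite !pair_big_dep /=.
rewrite (reindex_onto (fun q : {set V} * V => (q.2 |: q.1, q.2))
                      (fun q : {set V} * V => (q.1 :\ q.2, q.2))) /=; last first.
  by case=> S u /= /andP[_ uS]; rewrite setD1K.
apply: eq_big => [[U v]|[U v]] /=; last first.
  by case/andP => _ /eqP[->].
rewrite setU11 andbT xpair_eqE eqxx andbT.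
case: (boolP (v \in U)) => vU.
  have -> : (v \in cnbr e U) = false.
    by apply/negbTE; apply: contraL vU; apply: cnbr_notin.
  rewrite andbF; apply/negbTE; apply/nandP; right.
  by apply: contraTneq vU => <-; rewrite !inE eqxx.
rewrite setU1K // eqxx andbT cliqueU1 // cardsU1 vU add1n eqSS.
by rewrite -!andbA [(_ \in _) && _]andbC.
Qed.

Hypothesis p_ge0 : forall v, 0 <= p v.

Lemma wt_ge0 A : 0 <= wt A. Proof. by apply: prodr_ge0. Qed.
Lemma mass_ge0 A : 0 <= mass A. Proof. by apply: sumr_ge0. Qed.
Lemma cliquew_ge0 e s : 0 <= cliquew e s.
Proof. by apply: sumr_ge0 => S _; apply: wt_ge0. Qed.

Lemma wtD1 (A : {set V}) u : u \in A -> wt A = wt (A :\ u) * p u.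
Proof. by move=> uA; rewrite /wt (big_setD1 u) //= mulrC. Qed.

Hypothesis p_sum : \sum_v p v = 1.

Section OneRel.
Variable e : rel V.
Hypotheses (sym : symmetric e) (irr : irreflexive e).

Lemma sum_clique_mass s :
  \sum_(U : {set V} | clique e U && (#|U| == s)) wt U * mass (cnbr e U) =
    s.+1%:R * cliquew e s.+1.
Proof.
under eq_bigr do rewrite /mass mulr_sumr.
rewrite -(sum_clique_rem s (fun U v => wt U * p v)) // mulr_sumr.
apply: eq_bigr => S /andP[_ /eqP cS].
rewrite (eq_bigr (fun _ => wt S)); last by move=> u uS; rewrite -wtD1.
by rewrite sumr_const cS mulr_natl.
Qed.

(** A vertex adjacent to all of [S :\ u] either misses [u], hence exactly [u], or sees all of
    [S]. *)
Lemma mass_cnbrD1 (S : {set V}) u : u \in S ->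
  mass (cnbr e (S :\ u)) = mass (cpart e S u) + mass (cnbr e S).
Proof.
move=> uS.
rewrite /mass (bigID (fun v => e v u)) /= addrC; congr (_ + _).
  apply: eq_bigl => v; apply/andP/cpartP.
    case=> /cnbrP vn nvu w wS; case: eqP => [->|/eqP wu]; first exact: negbTE.
    by apply: vn; rewrite !inE wu.
  move=> H; split; last by rewrite H // eqxx.
  by apply/cnbrP => w; rewrite !inE => /andP[wu wS]; rewrite H.
apply: eq_bigl => v; apply/andP/cnbrP.
  case=> /cnbrP vn vu w wS; case: (eqVneq w u) => [->//|wu].
  by apply: vn; rewrite !inE wu.
by move=> H; split; [apply/cnbrP => w; rewrite !inE => /andP[_]; apply: H|apply: H].
Qed.

Lemma sum_massE (I : finType) (P : pred I) (B : I -> {set V}) :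
  \sum_(i | P i) mass (B i) = \sum_v \sum_(i | P i && (v \in B i)) p v.
Proof.
rewrite /mass (exchange_big_dep predT) //=.
Qed.

Lemma cpart_eq (S : {set V}) v u w :
  u \in S -> v \in cpart e S u -> v \in cpart e S w -> u = w.
Proof.
move=> uS /cpartP /(_ u uS); rewrite eqxx => H /cpartP /(_ u uS).
by rewrite H => /esym/negbFE/eqP.
Qed.

(** The classes and the common neighbourhood are pairwise disjoint: a vertex determines which
    elements of [S] it misses. *)
Lemma sum_mass_cpart (S : {set V}) :
  \sum_(u in S) mass (cpart e S u) + mass (cnbr e S) <= 1.
Proof.
rewrite sum_massE /mass [X in _ + X]big_mkcond /= -big_split /= -p_sum.
apply: ler_sum => v _.
case: (pickP (fun u => (u \in S) && (v \in cpart e S u))) => [u /andP[uS vu]|H].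
  rewrite (bigD1 u) /= ?uS ?vu // big1 => [|w /andP[/andP[wS vw]]]; last first.
    by rewrite (cpart_eq wS vw vu) eqxx.
  case: ifP => [/cnbrP/(_ u uS)|]; last by rewrite !addr0.
  by move/cpartP: vu => -> //; rewrite eqxx.
by rewrite big_pred0 // add0r; case: ifP.
Qed.

(** One factor of the square is spent on extending [U] to a clique [S] by a vertex; the other
    becomes [mass (cnbr e (S :\ u))] and splits by [mass_cnbrD1]. *)
Lemma sum_clique_mass_sqr s :
  \sum_(U : {set V} | clique e U && (#|U| == s)) wt U * mass (cnbr e U) ^+ 2 =
  \sum_(S : {set V} | clique e S && (#|S| == s.+1))
     wt S * \sum_(u in S) mass (cpart e S u)
  + s.+1%:R * s.+2%:R * cliquew e s.+2.
Proof.
rewrite -mulrA -sum_clique_mass.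
rewrite (eq_bigr (fun U => \sum_(v in cnbr e U) wt U * p v * mass (cnbr e U))).
  rewrite -(sum_clique_rem s (fun U v => wt U * p v * mass (cnbr e U))) //.
  rewrite mulr_sumr -big_split /=; apply: eq_bigr => S /andP[_ /eqP cS].
  rewrite (eq_bigr (fun u => wt S * mass (cpart e S u) + wt S * mass (cnbr e S))).
    by rewrite big_split /= sumr_const cS mulr_natl -mulr_sumr.
  by move=> u uS; rewrite -wtD1 // mass_cnbrD1 // mulrDr.
by move=> U _; rewrite /mass -mulr_suml -mulr_sumr; ring.
Qed.

Lemma sum_clique_mass_ge s :
  s.+1%:R ^+ 2 * cliquew e s.+1 ^+ 2 <=
  cliquew e s *
   (\sum_(S : {set V} | clique e S && (#|S| == s.+1))
     wt S * (\sum_(u in S) mass (cpart e S u))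
    + s.+1%:R * s.+2%:R * cliquew e s.+2).
Proof.
rewrite -sum_clique_mass_sqr -exprMn -sum_clique_mass.
by apply: weighted_cauchy_schwarz => S _; apply: wt_ge0.
Qed.

(** The weighted Moon-Moser inequality. The classes of [S] have total mass at most 1 minus that of
    the common neighbourhood, which lowers the coefficient (s+1)(s+2) to (s+1)(s+2) - (s+2) =
    (s+1)^2 - 1. *)
Lemma moon_moser s :
  s.+1%:R ^+ 2 * cliquew e s.+1 ^+ 2 <=
  cliquew e s * (cliquew e s.+1 + (s.+1%:R ^+ 2 - 1) * cliquew e s.+2).
Proof.
apply: le_trans (sum_clique_mass_ge s) _.
apply: ler_wpM2l; first exact: cliquew_ge0.
have H : \sum_(S : {set V} | clique e S && (#|S| == s.+1))
     wt S * (\sum_(u in S) mass (cpart e S u)) +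
     \sum_(S : {set V} | clique e S && (#|S| == s.+1))
     wt S * mass (cnbr e S) <= cliquew e s.+1.
  rewrite -big_split /=; apply: ler_sum => S _; rewrite -mulrDr.
  by rewrite ler_piMr ?wt_ge0 ?sum_mass_cpart.
rewrite sum_clique_mass -[s.+2]addn1 natrD in H *.
set A := \sum_(S | _) _ in H *; nra.
Qed.

Lemma clique_card0 (S : {set V}) : clique e S && (#|S| == 0) = (S == set0).
Proof.
rewrite cards_eq0; case: eqP => [->|]; last by rewrite andbF.
by rewrite andbT; apply/cliqueP => x y; rewrite inE.
Qed.

Lemma cliquew0 : cliquew e 0 = 1.
Proof. by rewrite /cliquew (big_pred1 set0 clique_card0) /wt big_set0. Qed.

Lemma cnbr0 : cnbr e set0 = setT.
Proof. by apply/setP => v; rewrite [RHS]inE; apply/cnbrP => u; rewrite inE. Qed.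

Lemma cliquew1 : cliquew e 1 = 1.
Proof.
have := sum_clique_mass 0; rewrite mul1r => <-.
rewrite (big_pred1 set0 clique_card0) /wt big_set0 cnbr0 mul1r /mass.
by rewrite -p_sum; apply: eq_bigl => v; rewrite inE.
Qed.

Lemma cliquew2 : 2 * cliquew e 2 = \sum_(q : V * V | e q.1 q.2) p q.1 * p q.2.
Proof.
rewrite -sum_clique_mass.
rewrite (eq_bigr (fun U : {set V} => \sum_(v in U) p v * mass (cnbr e [set v]))).
  have := @sum_clique_rem e 0 (fun _ v => p v * mass (cnbr e [set v])) sym irr.
  move=> ->.
  rewrite (big_pred1 set0 clique_card0) cnbr0.
  rewrite -(pair_big_dep predT (fun i j => e i j) (fun i j => p i * p j)) /=.
  apply: eq_big => [v|v _]; first by rewrite inE.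
  rewrite mulr_sumr; apply: eq_bigl => w; rewrite sym.
  by apply/cnbrP/idP => [->//|wv u]; rewrite inE ?eqxx // => /eqP->.
move=> U /andP[_ /cards1P[u ->]].
by rewrite !big_set1 /wt big_set1.
Qed.

(** Moon-Moser says that the ratios q_s = (s+1) e_(s+1) / e_s of clique weights satisfy (s+1) q_s <=
    1 + s q_(s+1), so q_s >= 1 - s th propagates from s = 1. The balanced complete r-partite graph,
    with th = 1/r, gives equality. *)
Lemma cliquew_step (th : R) s : (0 < s)%N -> 
  (forall k, (k < s)%N -> 0 < cliquew e k) ->
  1 - th <= 2 * cliquew e 2 ->
  (1 - s%:R * th) * cliquew e s <= s.+1%:R * cliquew e s.+1.
Proof.
case: s => // s _ + h2; elim: s => [|s IH] pos.
  by rewrite cliquew1 mul1r mulr1.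
have {}IH := IH (fun k ks => pos k (ltn_trans ks (ltnSn _))).
have es : 0 < cliquew e s.+1 by apply: pos.
have M := moon_moser s.+1.
have e0 := cliquew_ge0 e s.+2.
(* Multiplying the induction hypothesis by the next clique weight needs only its nonnegativity; the
   only clique weight divided by later is [cliquew e s.+1]. *)
have := ler_wpM2l e0 IH.
have n0 : 0 <= s%:R :> R by [].
have E1 : s.+1%:R = s%:R + 1 :> R by rewrite natr1.
have E2 : s.+2%:R = s%:R + 2 :> R by rewrite -natr1 E1; ring.
have E3 : s.+3%:R = s%:R + 3 :> R by rewrite -natr1 E2; ring.
rewrite E1 E2 E3 in IH M *.
set x := cliquew e s.+1 in es IH M *; set y := cliquew e s.+2 in IH M e0 *.
set z := cliquew e s.+3 in M *; set n : R := s%:R in n0 IH M E1 E2 E3 *.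
move=> Q; rewrite -(ler_pM2l es) -(ler_pM2l (_ : 0 < n + 1)); last lra.
rewrite -subr_ge0 in M; rewrite -subr_ge0 in Q; rewrite -subr_ge0.
have := mulr_ge0 (_ : 0 <= n + 2) Q => /(_ ltac:(lra)); nra.
Qed.

End OneRel.
End WeightedCliques.

(** * Stability of the weighted edge density *)

Section DensityStability.
Variables (R : realFieldType) (V : finType) (p : V -> R) (e : rel V).
Hypotheses (p_ge0 : forall v, 0 <= p v) (p_sum : \sum_v p v = 1).
Hypotheses (sym : symmetric e) (irr : irreflexive e).


(** Product of the ratio bounds: [b] is below every factor 1 - k th with k < r. Strong induction
    supplies the positivity required by [cliquew_step]. *)
Lemma cliquew_lower (th b : R) r s : 1 - th <= 2 * cliquew p e 2 ->
  0 < b -> b <= 1 -> b <= 1 - r.-1%:R * th -> (s <= r)%N ->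
  b ^+ s <= s`!%:R * cliquew p e s.
Proof.
move=> h2 b0 b1 bth; elim/ltn_ind: s => -[|[|s]] IH sr.
- by rewrite cliquew0 mulr1.
- by rewrite cliquew1 // mulr1.
have pos k : (k < s.+2)%N -> 0 < cliquew p e k.
  move=> ks; have := IH k ks (leq_trans (ltnW ks) sr).
  move=> /(lt_le_trans (exprn_gt0 k b0)).
  by rewrite pmulr_rgt0 // ltr0n fact_gt0.
have := cliquew_step p_ge0 p_sum sym irr (ltn0Sn s)
   (fun k ks => pos k (ltn_trans ks (ltnSn _))) h2.
have {}IH := IH s.+1 (ltnSn _) (ltnW sr).
(* For th >= 0 the smallest factor is the one with k = r - 1; for th < 0 all factors exceed 1. *)
have bs : b <= 1 - s.+1%:R * th.
  have [th0|th0] := lerP 0 th; last first.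
    rewrite (le_trans b1) // lerDl oppr_ge0 mulr_ge0_le0 //; exact: ltW.
  apply: le_trans bth _; rewrite lerD2l lerN2 ler_wpM2r // ler_nat.
  by case: r sr.
have e0 : 0 <= cliquew p e s.+1 by exact: cliquew_ge0.
move=> H; rewrite exprS [s.+2`!]factS natrM -mulrA.
have f0 : 0 <= (s.+1)`!%:R :> R by [].
set c := cliquew p e s.+1 in H IH e0 *.
apply: (@le_trans _ _ (b * ((s.+1)`!%:R * c))); first by rewrite ler_pM2l.
rewrite mulrCA [leRHS]mulrCA; apply: ler_wpM2l => //.
by apply: le_trans H; apply: ler_wpM2r.
Qed.

Lemma cliquew_lower_gt0 (th b : R) r s : 1 - th <= 2 * cliquew p e 2 ->
  0 < b -> b <= 1 -> b <= 1 - r.-1%:R * th -> (s <= r)%N ->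
  0 < cliquew p e s.
Proof.
move=> h2 b0 b1 bth sr; have := cliquew_lower h2 b0 b1 bth sr.
move/(lt_le_trans (exprn_gt0 s b0)).
by rewrite pmulr_rgt0 // ltr0n fact_gt0.
Qed.

(* The Motzkin-Straus bound, robust to a small density of (r+1)-cliques. *)
Lemma edge_density_le r (d : R) : (2 <= r)%N -> 0 < d ->
  (r.+1)`!%:R * cliquew p e r.+1 < d * r%:R^-1 ^+ r ->
  2 * cliquew p e 2 <= 1 - r%:R^-1 + d.
Proof.
move=> r2 d0 H; rewrite leNgt; apply/negP => Q.
have rr : 0 < r%:R :> R by rewrite ltr0n (leq_trans _ r2).
set i : R := r%:R^-1 in H Q.
have i0 : 0 < i by rewrite invr_gt0.
have ri : r%:R * i = 1 by rewrite divff // gt_eqF.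
have i1 : i <= 1 by rewrite invf_le1 // ler1n (leq_trans _ r2).
have r1E : r.-1%:R = r%:R - 1 :> R.
  by case: r r2 {H rr ri i i0 i1 Q} => // r _; rewrite -natr1 addrK.
pose th := 1 - 2 * cliquew p e 2.
have h2 : 1 - th <= 2 * cliquew p e 2 by rewrite /th; lra.
have thi : th < i - d by rewrite /th; lra.
have r1 : 1 <= r%:R :> R by rewrite ler1n (leq_trans _ r2).
(* Since th < 1/r - d, the value 1/r can serve as the lower bound [b]. *)
have bth : i <= 1 - r.-1%:R * th.
  rewrite r1E; nra.
have low := cliquew_lower h2 i0 i1 bth (leqnn r).
have pos k : (k < r)%N -> 0 < cliquew p e k.
  by move=> kr; apply: (cliquew_lower_gt0 h2 i0 i1 bth (ltnW kr)).
(* The step at level r has factor 1 - r th > r d >= d, so it produces more (r+1)-cliques than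
   assumed. *)
have := cliquew_step p_ge0 p_sum sym irr (ltnW r2) pos h2.
apply/negP; rewrite -ltNge.
have f0 : 0 < r`!%:R :> R by rewrite ltr0n fact_gt0.
rewrite -(ltr_pM2l f0) mulrA -natrM mulnC -factS.
apply: lt_le_trans H _; rewrite [leRHS]mulrCA.
apply: ler_pM => //; [exact: ltW|by rewrite exprn_ge0 // ltW|nra].
Qed.

Definition cross (S : {set V}) : rel V := fun v w =>
  [exists u in S, exists u' in S,
    [&& u != u', v \in cpart e S u & w \in cpart e S u']].

Lemma crossP (S : {set V}) v w :
  reflect (exists u u', [/\ u \in S, u' \in S, u != u',
             v \in cpart e S u & w \in cpart e S u'])
          (cross S v w).
Proof.
apply: (iffP exists_inP).
  by case=> u uS /exists_inP[u' u'S /and3P[? ? ?]]; exists u, u'.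
by case=> u [u' [? ? ? ? ?]]; exists u => //; apply/exists_inP; exists u' => //; apply/and3P.
Qed.

Definition inner (S : {set V}) (u : V) : R :=
  \sum_(v in cpart e S u) \sum_(w in cpart e S u | e v w) p v * p w.

(** An edge inside the class of [u] completes [S :\ u] to a clique with one vertex more than [S].
    Averaged over [S], inner edges are therefore paid for by larger cliques. *)
Lemma sum_clique_inner s :
  \sum_(S : {set V} | clique e S && (#|S| == s.+1)) wt p S * \sum_(u in S) inner S u
   <= s.+1%:R * s.+2%:R * cliquew p e s.+2.
Proof.
(* [J U] is the weight of the ordered edges inside the common neighbourhood of [U]; it bounds
   [inner S u] for [U = S :\ u]. *)
pose J (U : {set V}) := \sum_(v in cnbr e U) p v * mass p (cnbr e (v |: U)).
have J0 U : 0 <= J U.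
  by apply: sumr_ge0 => v _; rewrite mulr_ge0 ?mass_ge0.
apply: (@le_trans _ _ (\sum_(S : {set V} | clique e S && (#|S| == s.+1))
   \sum_(u in S) wt p (S :\ u) * p u * J (S :\ u))).
  apply: ler_sum => S _; rewrite mulr_sumr; apply: ler_sum => u uS.
  rewrite -wtD1 // ler_wpM2l ?wt_ge0 // /inner /J.
  have sub v : v \in cpart e S u -> v \in cnbr e (S :\ u).
    move/cpartP => H; apply/cnbrP => w; rewrite !inE => /andP[wu wS].
    by rewrite H.
  rewrite [leRHS](bigID (fun v => v \in cpart e S u)) /=.
  rewrite -[leLHS]addr0 lerD //; last first.
    by apply: sumr_ge0 => v _; rewrite mulr_ge0 ?mass_ge0.
  rewrite [leRHS](eq_bigl (fun v => v \in cpart e S u)); last first.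
    by move=> v /=; case: (boolP (v \in cpart e S u)) => [/sub->|]; rewrite ?andbF.
  apply: ler_sum => v vu; rewrite /mass mulr_sumr.
  rewrite [leRHS](bigID (fun w => w \in cpart e S u)) /=.
  rewrite -[leLHS]addr0 lerD //; last by apply: sumr_ge0 => w _; rewrite mulr_ge0.
  rewrite le_eqVlt; apply/orP; left; apply/eqP; apply: eq_bigl => w.
  case: (boolP (w \in cpart e S u)) => [wu|]; rewrite ?andbF //= andbT.
  apply/idP/cnbrP => [vw z|/(_ v)]; last by rewrite sym; apply; rewrite setU11.
  rewrite in_setU1 => /orP[/eqP->|]; first by rewrite sym.
  by move: (sub _ wu) => /cnbrP; apply.
rewrite (sum_clique_rem s (fun U v => wt p U * p v * J U)) //.
(* The removed vertex [u] now enters only through its weight, and these weights add up to at most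
   1. *)
apply: (@le_trans _ _ (\sum_(U : {set V} | clique e U && (#|U| == s)) wt p U * J U)).
  apply: ler_sum => U _; rewrite -mulr_suml -mulr_sumr.
  rewrite ler_wpM2r // ler_piMr ?wt_ge0 // -p_sum.
  rewrite [leRHS](bigID (fun v => v \in cnbr e U)) /= lerDl.
  by apply: sumr_ge0.
rewrite (eq_bigr (fun U => \sum_(v in cnbr e U)
    wt p U * p v * mass p (cnbr e (v |: U)))); last first.
  by move=> U _; rewrite /J mulr_sumr; apply: eq_bigr => v _; rewrite mulrA.
rewrite -(sum_clique_rem s (fun U v => wt p U * p v * mass p (cnbr e (v |: U)))) //.
rewrite -mulrA -sum_clique_mass // mulr_sumr; apply: ler_sum => S /andP[_ /eqP cS].
rewrite (eq_bigr (fun=> wt p S * mass p (cnbr e S))).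
  by rewrite sumr_const cS mulr_natl.
by move=> u uS; rewrite -wtD1 // setD1K.
Qed.

(** The two failures of the classes of [S] to be a proper partition: mass left uncovered, and weight
    of edges inside classes. *)
Definition defect (S : {set V}) : R :=
  (1 - \sum_(u in S) mass p (cpart e S u)) + \sum_(u in S) inner S u.

(** The average of [defect] over r-cliques, weighted by [wt], is at most the stated bound:
    Cauchy-Schwarz together with the ratio q_(r-1) controls the uncovered mass, and
    [sum_clique_inner] the inner edges. *)
Lemma exists_good_clique r (z z' b : R) : (2 <= r)%N ->
  1 - (r%:R^-1 + z) <= 2 * cliquew p e 2 ->
  0 < b -> b <= 1 -> b <= 1 - r.-1%:R * (r%:R^-1 + z) ->
  cliquew p e r.+1 <= z' * cliquew p e r ->
  exists S : {set V}, [/\ clique e S, #|S| = r &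
    defect S <= r%:R * (r%:R - 1) * z + 2 * r%:R * (r%:R + 1) * z'].
Proof.
case: r => // s r2; set r := s.+1 => h2 b0 b1 bth hz.
(* The term in [z] is the loss in the ratio step; r(r+1) z' occurs twice, once from Cauchy-Schwarz
   and once from the inner edges. *)
pose B := r%:R * (r%:R - 1) * z + 2 * r%:R * (r%:R + 1) * z'; rewrite -/B.
have er : 0 < cliquew p e r by apply: (cliquew_lower_gt0 h2 b0 b1 bth).
have er1 : 0 < cliquew p e s by apply: (cliquew_lower_gt0 h2 b0 b1 bth).
have pos k : (k < s)%N -> 0 < cliquew p e k.
  by move=> kr; apply: (cliquew_lower_gt0 h2 b0 b1 bth (leqW (ltnW kr))).
have st := cliquew_step p_ge0 p_sum sym irr r2 pos h2.
have ge := sum_clique_mass_ge p_ge0 sym irr s.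
have inn := sum_clique_inner s.
rewrite -/r in st ge.
set T := \sum_(S | _) wt p S * (\sum_(u in S) mass p _) in ge.
set I := \sum_(S | _) wt p S * (\sum_(u in S) inner _ _) in inn.
have sr : s%:R = r%:R - 1 :> R by rewrite -natr1 addrK.
have rr : 0 < r%:R :> R by [].
have ri : r%:R * r%:R^-1 = 1 :> R by rewrite divff // gt_eqF.
have rE : (r.+1)%:R = r%:R + 1 :> R by rewrite -natr1.
have tot : \sum_(S : {set V} | clique e S && (#|S| == r)) wt p S * defect S =
   cliquew p e r - T + I.
  rewrite /cliquew -sumrB -big_split /=; apply: eq_bigr => S _.
  by rewrite /defect; ring.
have totle : cliquew p e r - T + I <= B * cliquew p e r.
  rewrite rE in ge inn; rewrite sr in st.
  have : cliquew p e s * ((1 - r%:R * (r%:R - 1) * z) * cliquew p e r) <=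
         cliquew p e s * (T + r%:R * (r%:R + 1) * cliquew p e r.+1).
    apply: le_trans ge.
    have := ler_wpM2l (mulr_ge0 (ltW rr) (ltW er)) st.
    have -> : (1 - (r%:R - 1) * (r%:R^-1 + z)) = r%:R^-1 - (r%:R - 1) * z.
      by rewrite mulrDr mulrBl ri mul1r; ring.
    move=> K; apply: le_trans (le_trans K _); last by rewrite le_eqVlt; apply/orP; left; apply/eqP; ring.
    rewrite le_eqVlt; apply/orP; left; apply/eqP.
    transitivity (cliquew p e s * cliquew p e r * (r%:R * r%:R^-1 - r%:R * (r%:R - 1) * z)).
      by rewrite ri; ring.
    by ring.
  rewrite ler_pM2l // => K.
  have : r%:R * (r%:R + 1) * cliquew p e r.+1 <= r%:R * (r%:R + 1) * (z' * cliquew p e r).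
    by apply: ler_wpM2l => //; rewrite mulr_ge0 //; lra.
  rewrite /B; nra.
rewrite -tot in totle.
case: (pickP (fun S : {set V} => [&& clique e S, #|S| == r & defect S <= B])) => [S|H].
  by case/and3P => ? /eqP ? ?; exists S.
(* Cliques of weight zero do not affect the average, so one of positive weight is needed to make the
   contradiction strict. *)
have /existsP[S /and3P[cS sS wS]] : [exists S : {set V}, [&& clique e S, #|S| == r & 0 < wt p S]].
  apply: contraTT er => /existsPn H'; rewrite -leNgt; apply: sumr_le0 => S /andP[cS sS].
  by have := H' S; rewrite cS sS /= -leNgt.
exfalso; move: totle; apply/negP; rewrite -ltNge /cliquew mulr_sumr.
rewrite [ltLHS](bigD1 S) ?cS //= [ltRHS](bigD1 S) ?cS //=.
have D S' : clique e S' -> #|S'| == r -> B < defect S'.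
  by move=> c1 c2; rewrite ltNge; have := H S'; rewrite c1 c2 /= => ->.
apply: ltr_leD; first by rewrite mulrC ltr_pM2l // D.
apply: ler_sum => S' /andP[/andP[c1 c2] _].
by rewrite mulrC ler_wpM2l ?wt_ge0 // ltW // D.
Qed.

(** An edge that does not cross has an endpoint in no class, which costs the uncovered mass once per
    end, or both endpoints in the same class. *)
Lemma extra_le (S : {set V}) :
  \sum_(q : V * V | e q.1 q.2 && ~~ cross S q.1 q.2) p q.1 * p q.2
    <= 2 * (1 - \sum_(u in S) mass p (cpart e S u)) + \sum_(u in S) inner S u.
Proof.
pose bad := [set v | [forall u in S, v \notin cpart e S u]].
have badE : mass p bad = 1 - \sum_(u in S) mass p (cpart e S u).
  apply/eqP; rewrite eq_sym subr_eq eq_sym; apply/eqP.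
  rewrite sum_massE /mass [X in X + _]big_mkcond /= -big_split /= -p_sum.
  apply: eq_bigr => v _; rewrite inE; case: ifP => [/forall_inP H|/negbT].
    by rewrite big_pred0 ?addr0 // => u; apply/negP => /andP[/H/negP].
  rewrite negb_forall_in => /exists_inP[u uS]; rewrite negbK => vu.
  rewrite add0r (bigD1 u) /= ?uS ?vu // big1 ?addr0 // => w /andP[/andP[wS vw]].
  by rewrite (cpart_eq wS vw vu) eqxx.
rewrite -badE /inner.
have E1 : mass p bad = \sum_(q : V * V) (if q.1 \in bad then p q.1 * p q.2 else 0).
  rewrite -(pair_bigA _ (fun v w => if v \in bad then p v * p w else 0)) /=.
  rewrite /mass big_mkcond /=; apply: eq_bigr => v _.
  by case: ifP => _; rewrite -?mulr_sumr ?p_sum ?mulr1 // big1.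
have E2 : mass p bad = \sum_(q : V * V) (if q.2 \in bad then p q.1 * p q.2 else 0).
  rewrite -(pair_bigA _ (fun v w => if w \in bad then p v * p w else 0)) /=.
  rewrite exchange_big /mass big_mkcond /=; apply: eq_bigr => v _.
  by case: ifP => _; rewrite -?mulr_suml ?p_sum ?mul1r // big1.
have E3 : \sum_(u in S) \sum_(v in cpart e S u)
    \sum_(w in cpart e S u | e v w) p v * p w =
  \sum_(q : V * V) \sum_(u in S | [&& q.1 \in cpart e S u, q.2 \in cpart e S u
     & e q.1 q.2]) p q.1 * p q.2.
  rewrite [RHS](exchange_big_dep (mem S)) /=; last by move=> ? ? _ /andP[].
  apply: eq_bigr => u uS; rewrite pair_big_dep /=.
  by apply: eq_bigl => q; rewrite uS.
rewrite mulr_natl mulr2n {1}E1 {1}E2 E3 -!big_split /= big_mkcond /=.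
apply: ler_sum => -[v w] _ /=.
have pp : 0 <= p v * p w by rewrite mulr_ge0.
have s0 : 0 <= \sum_(u in S | [&& v \in cpart e S u, w \in cpart e S u & e v w])
   p v * p w by apply: sumr_ge0.
have i0 b : 0 <= (if b then p v * p w else 0) by case: b.
case: ifP; last by rewrite !addr_ge0.
case/andP => vw nc.
case: (boolP (v \in bad)) => [_|]; first by rewrite -addrA lerDl addr_ge0.
case: (boolP (w \in bad)) => [_ _|]; first by rewrite add0r lerDl.
rewrite !inE !negb_forall_in => /exists_inP[u' u'S]; rewrite negbK => wu'.
move=> /exists_inP[u uS]; rewrite negbK => vu.
rewrite !add0r (bigD1 u) /=; first by rewrite lerDl; apply: sumr_ge0.
rewrite uS vu vw andbT /=; case: (eqVneq u u') => [->//|uu'].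
by case/negP: nc; apply/crossP; exists u, u'.
Qed.

Lemma sum_cross (S : {set V}) :
  \sum_(q : V * V | cross S q.1 q.2) p q.1 * p q.2 =
  (\sum_(u in S) mass p (cpart e S u)) ^+ 2 - \sum_(u in S) mass p (cpart e S u) ^+ 2.
Proof.
apply/eqP; rewrite eq_sym subr_eq; apply/eqP.
have E : (\sum_(u in S) mass p (cpart e S u)) ^+ 2 =
  \sum_(u in S) \sum_(u' in S | u' != u) mass p (cpart e S u) * mass p (cpart e S u')
   + \sum_(u in S) mass p (cpart e S u) ^+ 2.
  rewrite expr2 big_distrlr /= -big_split /=; apply: eq_bigr => u uS.
  by rewrite (bigD1 u) //= addrC expr2.
rewrite E; congr (_ + _).
rewrite pair_big_dep /=.
under eq_bigr => q _ do rewrite /mass big_distrlr /= pair_big_dep /=.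
rewrite (exchange_big_dep predT) //= [RHS]big_mkcond /=.
apply: eq_bigr => -[v w] _ /=.
case: ifP => [/crossP[u [u' [uS u'S uu' vu wu']]]|nc].
  rewrite (bigD1 (u, u')) /=; last by rewrite uS u'S vu wu' eq_sym uu'.
  rewrite big1 ?addr0 // => -[x y] /= /andP[/andP[/and3P[xS yS xy] /andP[vx wy]]].
  by rewrite (cpart_eq xS vx vu) (cpart_eq yS wy wu') eqxx.
rewrite big_pred0 // => -[x y] /=; apply/negP => /andP[/and3P[xS yS xy] /andP[vx wy]].
have : cross S v w by apply/crossP; exists x, y; rewrite eq_sym.
by rewrite nc.
Qed.

(** With s the total mass of the classes and i = 1/r, the crossing weight is s^2 - 2is + i minus the
    sum of the squared deviations from i. The first part is at most 1 - i, so a nearly extremal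
    density bounds the missing crossing weight and the deviations together. *)
Lemma good_clique_stability r (z B : R) (S : {set V}) : (2 <= r)%N ->
  1 - (r%:R^-1 + z) <= 2 * cliquew p e 2 ->
  #|S| = r -> defect S <= B ->
  [/\ \sum_(q : V * V | e q.1 q.2 && ~~ cross S q.1 q.2) p q.1 * p q.2 <= 2 * B,
      \sum_(q : V * V | cross S q.1 q.2 && ~~ e q.1 q.2) p q.1 * p q.2 <= z + 2 * B
    & forall u, u \in S -> (mass p (cpart e S u) - r%:R^-1) ^+ 2 <= z + 2 * B].
Proof.
move=> r2 h2 cS dS.
have I0 : 0 <= \sum_(u in S) inner S u.
  by apply: sumr_ge0 => u _; apply: sumr_ge0 => v _; apply: sumr_ge0 => w _; rewrite mulr_ge0.
have ex := extra_le S; have sc := sum_cross S.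
have s1 : \sum_(u in S) mass p (cpart e S u) <= 1.
  apply: le_trans (sum_mass_cpart p_ge0 p_sum e S); rewrite lerDl; exact: mass_ge0.
have s0 : 0 <= \sum_(u in S) mass p (cpart e S u).
  by apply: sumr_ge0 => u _; apply: mass_ge0.
have r0 : 0 < r%:R :> R by rewrite ltr0n (leq_trans _ r2).
have var : \sum_(u in S) (mass p (cpart e S u) - r%:R^-1) ^+ 2 =
   \sum_(u in S) mass p (cpart e S u) ^+ 2
   - 2 * r%:R^-1 * (\sum_(u in S) mass p (cpart e S u)) + r%:R^-1.
  have E : r%:R^-1 = \sum_(u in S) (r%:R^-1 ^+ 2) :> R.
    by rewrite sumr_const cS -[RHS]mulr_natl expr2 mulrA divff ?mul1r // gt_eqF.
  rewrite [X in _ = _ + X]E mulr_sumr -sumrB -big_split /=.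
  by apply: eq_bigr => u _; ring.
have i2 : r%:R^-1 <= 2^-1 :> R by rewrite lef_pV2 ?posrE // ler_nat.
rewrite cliquew2 // in h2.
set Q := \sum_(q | e _ _) _ in h2.
set s := \sum_(u in S) mass p _ in ex sc s1 s0 var dS *.
set X := \sum_(q | _ && ~~ cross _ _ _) _ in ex *.
set M := \sum_(q | cross _ _ _) _ in sc *.
set Y := \sum_(q | cross _ _ _ && _) _.
have bal : M - Y = Q - X.
  rewrite /M /Q (bigID (fun q : V * V => e q.1 q.2)) /=.
  rewrite [in RHS](bigID (fun q : V * V => cross S q.1 q.2)) /= !addrK.
  by apply: eq_bigl => q; rewrite andbC.
rewrite /defect in dS; set I := \sum_(u in S) inner S u in dS I0 ex.
have i0 : 0 <= r%:R^-1 :> R by rewrite invr_ge0 ltW.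
set i : R := r%:R^-1 in var i2 i0 h2 *.
(* The difference factors as (1 - s)(1 + s - 2i), with 0 <= s <= 1 and i <= 1/2. *)
have quad : s ^+ 2 - 2 * i * s + i <= 1 - i by nra.
have X2 : X <= 2 * B by rewrite -/s in dS; lra.
have Y0 : 0 <= Y by apply: sumr_ge0 => q _; rewrite mulr_ge0.
have v0 : 0 <= \sum_(u in S) (mass p (cpart e S u) - i) ^+ 2.
  by apply: sumr_ge0 => u _; rewrite sqr_ge0.
split=> //; first by lra.
move=> u uS; have : (mass p (cpart e S u) - i) ^+ 2 <=
   \sum_(u in S) (mass p (cpart e S u) - i) ^+ 2.
  by rewrite [leRHS](bigD1 u) //= lerDl; apply: sumr_ge0 => w _; rewrite sqr_ge0.
move=> /le_trans; apply; lra.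
Qed.

End DensityStability.

(** * From a near-extremal test vector to a partition *)

Lemma ler_sum_pred (R : realFieldType) (I : finType) (P Q : pred I) (F : I -> R) :
  (forall i, P i -> Q i) -> (forall i, Q i -> 0 <= F i) ->
  \sum_(i | P i) F i <= \sum_(i | Q i) F i.
Proof.
move=> PQ F0; rewrite [leRHS](bigID P) /= -[leLHS]addr0 lerD //.
  rewrite le_eqVlt; apply/orP; left; apply/eqP; apply: eq_bigl => i.
  by case: (boolP (P i)) => [/PQ->|]; rewrite ?andbF.
by apply: sumr_ge0 => i /andP[/F0].
Qed.

(** Serves twice: (x_a x_b)(x_a x_c) = x_a^2 (x_b x_c) on a triangle, and (x_v x_b)(x_w x_a) = (x_v
    x_w)(x_a x_b) on a path v - b - a - w. *)
Lemma pinned_factor (R : realFieldType) (lo hi al y1 y2 y3 z : R) :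
  0 < lo -> 0 < hi -> 0 < al -> 0 <= z -> y1 * y2 = z * y3 ->
  lo * al <= y1 -> y1 <= hi * al -> lo * al <= y2 -> y2 <= hi * al ->
  lo * al <= y3 -> y3 <= hi * al ->
  lo ^+ 2 / hi * al <= z <= hi ^+ 2 / lo * al.
Proof.
move=> lo0 hi0 al0 z0 E a1 b1 a2 b2 a3 b3.
have la : 0 < lo * al by rewrite mulr_gt0.
have low : (lo * al) * (lo * al) <= y1 * y2 by rewrite ler_pM // ltW.
have upp : y1 * y2 <= (hi * al) * (hi * al).
  by rewrite ler_pM // (le_trans _ a1, le_trans _ a2) // ltW.
have h1 := ler_wpM2l z0 a3; have h2 := ler_wpM2l z0 b3.
rewrite -E in h1 h2.
apply/andP; split.
  rewrite mulrAC ler_pdivrMr // -(ler_pM2r al0) -[leRHS]mulrA.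
  by apply: le_trans h2; apply: le_trans low; rewrite expr2 -!mulrA [al * _]mulrC -!mulrA.
rewrite mulrAC ler_pdivlMr // -(ler_pM2r al0) -[leLHS]mulrA.
by apply: (le_trans h1); apply: (le_trans upp); rewrite expr2 -!mulrA [al * (hi * _)]mulrCA.
Qed.

Section Truncation.
Variables (R : realFieldType) (V : finType) (e : rel V) (x : V -> R) (al : R).
Hypotheses (sym : symmetric e) (irr : irreflexive e).
Hypotheses (x_ge0 : forall v, 0 <= x v) (x_sum : \sum_v x v ^+ 2 = 1).
Hypothesis al_gt0 : 0 < al.

(** [al] is the value of [x v * x w] on every edge in the extremal case. Two windows are used: [d]
    to [d^-1] for the density bound, 1/2 to 2 for the partition. *)
Definition trunc (lo hi : R) : rel V := fun v w =>
  [&& e v w, lo * al <= x v * x w & x v * x w <= hi * al].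

Lemma trunc_sym lo hi : symmetric (trunc lo hi).
Proof. by move=> v w; rewrite /trunc sym [x v * x w]mulrC. Qed.

Lemma trunc_irr lo hi : irreflexive (trunc lo hi).
Proof. by move=> v; rewrite /trunc irr. Qed.

Lemma trunc_triangle lo hi a b c : 0 < lo -> 0 < hi ->
  trunc lo hi a b -> trunc lo hi a c -> trunc lo hi b c ->
  lo ^+ 2 / hi * al <= x a ^+ 2 <= hi ^+ 2 / lo * al.
Proof.
move=> lo0 hi0 /and3P[_ ab1 ab2] /and3P[_ ac1 ac2] /and3P[_ bc1 bc2].
apply: (pinned_factor lo0 hi0 al_gt0 (sqr_ge0 _) _ ab1 ab2 ac1 ac2 bc1 bc2).
by ring.
Qed.

Lemma trunc_path lo hi v w a b : 0 < lo -> 0 < hi ->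
  trunc lo hi v b -> trunc lo hi w a -> trunc lo hi a b ->
  lo ^+ 2 / hi * al <= x v * x w <= hi ^+ 2 / lo * al.
Proof.
move=> lo0 hi0 /and3P[_ vb1 vb2] /and3P[_ wa1 wa2] /and3P[_ ab1 ab2].
apply: (pinned_factor lo0 hi0 al_gt0 (mulr_ge0 _ _) _ vb1 vb2 wa1 wa2 ab1 ab2) => //.
by ring.
Qed.

Definition nclique (e' : rel V) (s : nat) : nat :=
  #|[set S : {set V} | clique e' S && (#|S| == s)]|.

Local Notation p := (fun v => x v ^+ 2).

(** As s >= 3, each vertex of the clique lies in a triangle of truncated edges, which bounds its
    weight. *)
Lemma cliquew_trunc_le lo hi s : 0 < lo -> 0 < hi -> (3 <= s)%N ->
  cliquew p (trunc lo hi) s <= (nclique e s)%:R * (hi ^+ 2 / lo * al) ^+ s.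
Proof.
move=> lo0 hi0 s3.
have h0 : 0 <= hi ^+ 2 / lo * al.
  by rewrite mulr_ge0 ?(ltW al_gt0) // divr_ge0 ?sqr_ge0 // ltW.
apply: (@le_trans _ _ (\sum_(S : {set V} | clique (trunc lo hi) S && (#|S| == s))
   (hi ^+ 2 / lo * al) ^+ s)).
  apply: ler_sum => S /andP[/cliqueP cS /eqP sS].
  rewrite -sS -prodr_const /wt; apply: ler_prod => v vS; rewrite sqr_ge0 /=.
  have : (1 < #|S :\ v|)%N by move: s3; rewrite -sS (cardsD1 v) vS.
  case/card_gt1P => a [b [aS bS ab]].
  move: aS bS; rewrite !inE => /andP[av aS] /andP[bv bS].
  have := @trunc_triangle lo hi v a b lo0 hi0.
  by case/(_ _ _ _)/andP => //; apply: cS => //; rewrite eq_sym.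
rewrite mulr_natl /nclique -sumr_const; apply: ler_sum_pred => [S|S _]; last exact: exprn_ge0.
rewrite inE => /andP[/cliqueP cS ->]; rewrite andbT; apply/cliqueP => a b aS bS ab.
by case/and3P: (cS a b aS bS ab).
Qed.

(** * Truncated edges of a near-extremal vector, and the partition they carry *)

Variables (r : nat) (d : R).
Hypotheses (r_ge2 : (2 <= r)%N) (d_gt0 : 0 < d).
Local Notation c := (1 - r%:R^-1 : R).
Hypothesis d_small : 88 * r%:R ^+ 2 * d <= 1.
Hypothesis arcs_le : al ^+ 2 *+ #|[set q : V * V | e q.1 q.2]| <= c.
Hypothesis rayleigh :
  (1 - d) * c <= al * \sum_(q : V * V | e q.1 q.2) x q.1 * x q.2.
Hypothesis few_cliques :
  (r.+1)`!%:R * ((nclique e r.+1)%:R * (al / d ^+ 3) ^+ r.+1)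
    < d * (2 * r%:R)^-1 ^+ r.

Local Notation E1 := (trunc d d^-1).
Local Notation E2 := (trunc 2^-1 2).
Local Notation eta := (140 * r%:R ^+ 2 * d).

Let r2 : 2 <= r%:R :> R. Proof. by rewrite ler_nat. Qed.
Let rr : r%:R * r%:R^-1 = 1 :> R.
Proof. by rewrite divff // pnatr_eq0; case: r r_ge2. Qed.
Let i0 : 0 < r%:R^-1 :> R. Proof. by rewrite invr_gt0; move: r2; lra. Qed.
Let i2 : r%:R^-1 <= 2^-1 :> R.
Proof. by rewrite lef_pV2 ?posrE //; move: r2; lra. Qed.
Let dsm : 352 * d <= 1.
Proof.
have r4 : 4 <= r%:R ^+ 2 :> R by move: r2; nra.
have := ler_wpM2r (ltW d_gt0) r4; move: d_small; lra.
Qed.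
Let p_ge0 v : 0 <= p v. Proof. exact: sqr_ge0. Qed.
Let xx0 v w : 0 <= x v * x w. Proof. by rewrite mulr_ge0. Qed.
Let al2 : 0 <= al ^+ 2. Proof. exact: sqr_ge0. Qed.

Let arcs_le' : \sum_(q : V * V | e q.1 q.2) al ^+ 2 <= c.
Proof.
apply: le_trans arcs_le; rewrite sumr_const.
by rewrite le_eqVlt; apply/orP; left; apply/eqP; congr (_ *+ _); apply: eq_card => q; rewrite !inE.
Qed.

Let sum_pp : \sum_(q : V * V) (x q.1 * x q.2) ^+ 2 = 1.
Proof.
rewrite -(pair_bigA _ (fun v w => (x v * x w) ^+ 2)) /=.
rewrite -[RHS]mulr1 -{1}x_sum mulr_suml; apply: eq_bigr => v _.
by rewrite -x_sum mulr_sumr; apply: eq_bigr => w _; rewrite exprMn.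
Qed.

(** An edge with product y < d al contributes al y <= d al^2, and one with y > al / d contributes al
    y <= d y^2. The loss is at most d c + d, where d <= 2 d c because c >= 1/2. *)
Lemma rayleigh_trunc :
  (1 - 4 * d) * c <= al * \sum_(q : V * V | E1 q.1 q.2) x q.1 * x q.2.
Proof.
have H : al * \sum_(q : V * V | e q.1 q.2) x q.1 * x q.2 <=
   d * (\sum_(q : V * V | e q.1 q.2) al ^+ 2) +
   d * (\sum_(q : V * V | e q.1 q.2) (x q.1 * x q.2) ^+ 2) +
   al * \sum_(q : V * V | E1 q.1 q.2) x q.1 * x q.2.
  rewrite [X in _ <= _ + al * X](eq_bigl (fun q : V * V => e q.1 q.2 &&
     ((d * al <= x q.1 * x q.2) && (x q.1 * x q.2 <= d^-1 * al)))) //.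
  rewrite big_mkcondr /= !mulr_sumr -!big_split /=; apply: ler_sum => -[v w] /= _.
  have := xx0 v w; set y := x v * x w => y0.
  have dal : 0 <= d * al ^+ 2 by rewrite mulr_ge0 // ltW.
  have dy : 0 <= d * y ^+ 2 by rewrite mulr_ge0 ?sqr_ge0 // ltW.
  have aly : 0 <= al * y by rewrite mulr_ge0 // ltW.
  have [lo|lo] := lerP (d * al) y; last first.
    rewrite mulr0 addr0 (le_trans _ (_ : d * al ^+ 2 <= _)) ?lerDl //.
    have -> : d * al ^+ 2 = al * (d * al) by ring.
    by apply: ler_wpM2l; apply: ltW.
  have [hi|hi] := lerP y (d^-1 * al); first by rewrite /= lerDr addr_ge0.
  rewrite /= mulr0 addr0 (le_trans _ (_ : d * y ^+ 2 <= _)) ?lerDr //.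
  rewrite expr2 mulrA ler_wpM2r //.
  by move: hi; rewrite mulrC ltr_pdivrMr // mulrC => /ltW.
have H2 : \sum_(q : V * V | e q.1 q.2) (x q.1 * x q.2) ^+ 2 <= 1.
  by rewrite -sum_pp; apply: ler_sum_pred => // q _; apply: sqr_ge0.
have := ler_wpM2l (ltW d_gt0) H2; have := ler_wpM2l (ltW d_gt0) arcs_le'.
move: i2 rayleigh H d_gt0; nra.
Qed.

Lemma cliquew_mono (e1 e2 : rel V) s : subrel e1 e2 ->
  cliquew p e1 s <= cliquew p e2 s.
Proof.
move=> sub; apply: ler_sum_pred => [S /andP[/cliqueP cS ->]|S _].
  by rewrite andbT; apply/cliqueP => a b aS bS ab; apply/sub/cS.
exact: wt_ge0.
Qed.

(** For the window [d] to [d^-1] the vertex bound hi^2 / lo is d^-3, whence [al / d ^+ 3] in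
    [few_cliques]. *)
Lemma few_trunc : (r.+1)`!%:R * cliquew p E1 r.+1 < d * (2 * r%:R)^-1 ^+ r.
Proof.
apply: le_lt_trans few_cliques; apply: ler_wpM2l => //.
have di : 0 < d^-1 by rewrite invr_gt0.
apply: (le_trans (cliquew_trunc_le d_gt0 di _)) => //.
apply: ler_wpM2l => //; rewrite le_eqVlt; apply/orP; left; apply/eqP.
by congr (_ ^+ _); rewrite exprVn -invfM -exprSr mulrC.
Qed.

Lemma sub_trunc : subrel E2 E1.
Proof.
move=> v w /and3P[vw l h]; rewrite /trunc vw /=; apply/andP; split.
  apply: le_trans l; rewrite ler_pM2r //; move: dsm; lra.
apply: (le_trans h); rewrite ler_pM2r //.
by rewrite -div1r ler_pdivlMr //; move: dsm; lra.
Qed.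

Lemma density_truncE E : symmetric E -> irreflexive E ->
  \sum_(q : V * V | E q.1 q.2) (x q.1 * x q.2) ^+ 2 = 2 * cliquew p E 2.
Proof.
move=> sE iE; rewrite (cliquew2 p sE iE).
by apply: eq_bigr => q _; rewrite exprMn.
Qed.

Lemma density_trunc_le : \sum_(q : V * V | E1 q.1 q.2) (x q.1 * x q.2) ^+ 2 <= c + d.
Proof.
rewrite density_truncE; [|exact: trunc_sym|exact: trunc_irr].
apply: (edge_density_le p_ge0 x_sum (@trunc_sym _ _) (@trunc_irr _ _)) => //.
(* Here 1/r would do; the smaller base 1/(2r) is the one that [exists_partition] needs. *)
apply: lt_le_trans few_trunc _; apply: ler_wpM2l; first exact: ltW.
have r0 : 0 < r%:R :> R by move: r2; lra.
apply: lerXn2r; rewrite ?nnegrE ?invr_ge0 //; first by move: r0; lra.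
by rewrite lef_pV2 ?posrE //; move: r0; lra.
Qed.

Let dev (E : rel V) := \sum_(q : V * V | E q.1 q.2) (x q.1 * x q.2 - al) ^+ 2.

(** Expand the square as Q - 2S + n, where Q <= c + d, n <= c and S >= (1 - 4d) c. This bounds the
    deviation above; its nonnegativity then bounds Q and n below. *)
Lemma dev_trunc :
  [/\ dev E1 <= 9 * d,
      c - 8 * d <= \sum_(q : V * V | E1 q.1 q.2) (x q.1 * x q.2) ^+ 2
    & c - 9 * d <= \sum_(q : V * V | E1 q.1 q.2) al ^+ 2].
Proof.
have E : dev E1 = \sum_(q : V * V | E1 q.1 q.2) (x q.1 * x q.2) ^+ 2
  - 2 * (al * \sum_(q : V * V | E1 q.1 q.2) x q.1 * x q.2)
  + \sum_(q : V * V | E1 q.1 q.2) al ^+ 2.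
  rewrite /dev !mulr_sumr -sumrB -big_split /=; apply: eq_bigr => q _; ring.
have D0 : 0 <= dev E1 by apply: sumr_ge0 => q _; apply: sqr_ge0.
have n1 : \sum_(q : V * V | E1 q.1 q.2) al ^+ 2 <= c.
  apply: le_trans arcs_le'; apply: ler_sum_pred => // q; by case/andP.
have := density_trunc_le; have := rayleigh_trunc.
move: E D0 n1 i2 i0 d_gt0.
set Q := \sum_(q | _) (_ * _) ^+ 2; set S := al * _; set n := \sum_(q | _) _ ^+ 2.
set D := dev _ => E D0 n1 h2 h0 d0 hS hQ; split; nra.
Qed.

(** Chebyshev: off the window from 1/2 to 2, both y^2 and al^2 are at most 4 (y - al)^2, so
    narrowing costs at most 4 * 9d = 36d, added to the losses 8d and 9d. *)
Lemma trunc2_bounds :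
  c - 44 * d <= 2 * cliquew p E2 2 /\
  \sum_(q : V * V | e q.1 q.2 && ~~ E2 q.1 q.2) al ^+ 2 <= 45 * d.
Proof.
have [D Q n] := dev_trunc.
rewrite -density_truncE; [|exact: trunc_sym|exact: trunc_irr].
have aux (y : R) : 0 <= y -> ~~ ((2^-1 * al <= y) && (y <= 2 * al)) ->
   y ^+ 2 <= 4 * (y - al) ^+ 2 /\ al ^+ 2 <= 4 * (y - al) ^+ 2.
  move=> y0; rewrite negb_and -!ltNge => /orP[] h; split; move: al_gt0; nra.
pose D' := \sum_(q : V * V | E1 q.1 q.2 && ~~ E2 q.1 q.2) (x q.1 * x q.2 - al) ^+ 2.
have DD : D' <= 9 * d.
  by apply: le_trans D; apply: ler_sum_pred => [q /andP[]|q _]; rewrite ?sqr_ge0.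
have split2 (f : V * V -> R) : \sum_(q : V * V | E1 q.1 q.2) f q =
    \sum_(q : V * V | E2 q.1 q.2) f q + \sum_(q : V * V | E1 q.1 q.2 && ~~ E2 q.1 q.2) f q.
  rewrite (bigID (fun q : V * V => E2 q.1 q.2)) /=; congr (_ + _).
  apply: eq_bigl => q; case: (boolP (E2 _ _)) => [/sub_trunc->//|_]; by rewrite andbF.
have auxE (q : V * V) : E1 q.1 q.2 && ~~ E2 q.1 q.2 ->
   ~~ ((2^-1 * al <= x q.1 * x q.2) && (x q.1 * x q.2 <= 2 * al)).
  by case/andP => /and3P[h _ _]; rewrite /trunc h.
have b1 : \sum_(q : V * V | E1 q.1 q.2 && ~~ E2 q.1 q.2) (x q.1 * x q.2) ^+ 2 <= 4 * D'.
  by rewrite mulr_sumr; apply: ler_sum => q /auxE/(aux _ (xx0 _ _))[].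
have b2 : \sum_(q : V * V | E1 q.1 q.2 && ~~ E2 q.1 q.2) al ^+ 2 <= 4 * D'.
  by rewrite mulr_sumr; apply: ler_sum => q /auxE/(aux _ (xx0 _ _))[].
rewrite split2 in Q; rewrite split2 in n.
split; first by lra.
have : \sum_(q : V * V | e q.1 q.2) al ^+ 2 =
    \sum_(q : V * V | E2 q.1 q.2) al ^+ 2
    + \sum_(q : V * V | e q.1 q.2 && ~~ E2 q.1 q.2) al ^+ 2.
  rewrite (bigID (fun q : V * V => E2 q.1 q.2)) /=; congr (_ + _).
  by apply: eq_bigl => q; rewrite /trunc; case: (e _ _).
have := arcs_le'; lra.
Qed.

(** [exists_good_clique] for the narrow window with z = 44d and z' = d gives defect at most 48 r^2
    d; [good_clique_stability] doubles this and adds z. *)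
Lemma exists_partition : exists S : {set V}, [/\ clique E2 S, #|S| = r,
  \sum_(q : V * V | E2 q.1 q.2 && ~~ cross E2 S q.1 q.2) (x q.1 * x q.2) ^+ 2 <= 96 * r%:R ^+ 2 * d,
  \sum_(q : V * V | cross E2 S q.1 q.2 && ~~ E2 q.1 q.2) (x q.1 * x q.2) ^+ 2 <= eta
  & forall u, u \in S -> (mass p (cpart E2 S u) - r%:R^-1) ^+ 2 <= eta].
Proof.
have [h2 _] := trunc2_bounds.
have h2' : 1 - (r%:R^-1 + 44 * d) <= 2 * cliquew p E2 2 by lra.
have r0 : 0 < r%:R :> R by move: r2; lra.
have rp : r.-1%:R = r%:R - 1 :> R by case: r r_ge2 => // n _; rewrite -natr1 addrK.
pose b : R := (2 * r%:R)^-1.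
have bE : b = 2^-1 * r%:R^-1 by rewrite /b invfM.
have b0 : 0 < b by rewrite invr_gt0; move: r0; lra.
have b1 : b <= 1 by rewrite bE; move: i2; lra.
have bth : b <= 1 - r.-1%:R * (r%:R^-1 + 44 * d).
  (* This is [d_small] divided by 2r; it keeps the factor for k = r - 1 above b = 1/(2r). *)
  have K : 44 * r%:R * d <= 2^-1 * r%:R^-1.
    rewrite -(ler_pM2l r0) [leRHS]mulrCA rr; move: d_small; lra.
  rewrite rp bE; move: rr K d_gt0; nra.
have sE := @trunc_sym 2^-1 2; have iE := @trunc_irr 2^-1 2.
(* The weight of r-cliques is bounded below in terms of b^r, while that of (r+1)-cliques is bounded
   above by [few_trunc] in terms of d b^r. *)
have hz : cliquew p E2 r.+1 <= d * cliquew p E2 r.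
  have low := cliquew_lower p_ge0 x_sum sE iE h2' b0 b1 bth (leqnn r).
  have f0 : 0 < r`!%:R :> R by rewrite ltr0n fact_gt0.
  rewrite -(ler_pM2l f0) [leRHS]mulrCA.
  apply: (le_trans _ (_ : d * b ^+ r <= _)); last by rewrite ler_pM2l.
  apply: le_trans (ltW few_trunc).
  apply: ler_pM => //; first by apply: cliquew_ge0.
    by rewrite ler_nat factS leq_pmull.
  exact: cliquew_mono sub_trunc.
have [S [cS sS dS]] := exists_good_clique p_ge0 x_sum sE iE r_ge2 h2' b0 b1 bth hz.
have dS' : defect p E2 S <= 48 * r%:R ^+ 2 * d.
  apply: (le_trans dS); move: r2 d_gt0; nra.
have [X Y var] := good_clique_stability p_ge0 x_sum sE iE r_ge2 h2' sS dS'.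
have K : 44 * d + 2 * (48 * r%:R ^+ 2 * d) <= eta by move: r2 d_gt0; nra.
exists S; split=> //.
- rewrite (eq_bigr (fun q => p q.1 * p q.2)); last by move=> q _; rewrite exprMn.
  by apply: (le_trans X); lra.
- rewrite (eq_bigr (fun q => p q.1 * p q.2)); last by move=> q _; rewrite exprMn.
  exact: (le_trans Y).
- by move=> u uS; apply: (le_trans (var u uS)).
Qed.

(** The path v - u' - u - w through [S] pins the product even when [v] and [w] are not adjacent; 8
    is 2^2 / (1/2). *)
Lemma cpart_prod (S : {set V}) v w : clique E2 S -> cross E2 S v w ->
  al <= 8 * (x v * x w) /\ x v * x w <= 8 * al.
Proof.
move=> /cliqueP cS /crossP[u [u' [uS u'S uu' /cpartP vu /cpartP wu']]].
have vu' : E2 v u' by rewrite vu // eq_sym.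
have wu : E2 w u by rewrite wu'.
have l0 : 0 < 2^-1 :> R by rewrite invr_gt0.
have /andP[h1 h2] := trunc_path l0 (ltr0Sn R 1) vu' wu (cS u u' uS u'S uu').
by split; lra.
Qed.

(** Weights become counts: al^2 is at most 4 (x_v x_w)^2 on edges of the narrow window, and at most
    64 (x_v x_w)^2 on crossing pairs. *)
Lemma sym_diff_le (S : {set V}) : clique E2 S ->
  \sum_(q : V * V | E2 q.1 q.2 && ~~ cross E2 S q.1 q.2) (x q.1 * x q.2) ^+ 2 <= 96 * r%:R ^+ 2 * d ->
  \sum_(q : V * V | cross E2 S q.1 q.2 && ~~ E2 q.1 q.2) (x q.1 * x q.2) ^+ 2 <= eta ->
  \sum_(q : V * V | e q.1 q.2 && ~~ cross E2 S q.1 q.2) al ^+ 2 <= 3 * eta /\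
  \sum_(q : V * V | cross E2 S q.1 q.2 && ~~ e q.1 q.2) al ^+ 2 <= 64 * eta.
Proof.
move=> cS X Y; split.
  have [_ h] := trunc2_bounds.
  have h' : \sum_(q : V * V | E2 q.1 q.2 && ~~ cross E2 S q.1 q.2) al ^+ 2 <= 4 * (96 * r%:R ^+ 2 * d).
    apply: le_trans (_ : 4 * \sum_(q : V * V | E2 q.1 q.2 && ~~ cross E2 S q.1 q.2) (x q.1 * x q.2) ^+ 2 <= _); last by rewrite ler_pM2l.
    rewrite mulr_sumr; apply: ler_sum => q /andP[/and3P[_ h1 h2] _].
    by move: al_gt0 h1; nra.
  have : \sum_(q : V * V | e q.1 q.2 && ~~ cross E2 S q.1 q.2) al ^+ 2 <=
    \sum_(q : V * V | e q.1 q.2 && ~~ E2 q.1 q.2) al ^+ 2 +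
    \sum_(q : V * V | E2 q.1 q.2 && ~~ cross E2 S q.1 q.2) al ^+ 2.
    rewrite (bigID (fun q : V * V => E2 q.1 q.2)) /= addrC.
    apply: lerD; apply: ler_sum_pred => // q.
      by case/andP => /andP[-> _] ->.
    by case/andP => /andP[_ ->] ->.
  have r4 : 4 <= r%:R ^+ 2 :> R by move: r2; nra.
  have r4d := ler_wpM2r (ltW d_gt0) r4; move=> /le_trans; apply.
  by apply: (le_trans (lerD h h')); move: d_gt0; lra.
apply: le_trans (_ : \sum_(q : V * V | cross E2 S q.1 q.2 && ~~ E2 q.1 q.2) al ^+ 2 <= _).
  by apply: ler_sum_pred => // q /andP[-> ne]; apply: contra ne => /andP[].
apply: le_trans (_ : 64 * \sum_(q : V * V | cross E2 S q.1 q.2 && ~~ E2 q.1 q.2) (x q.1 * x q.2) ^+ 2 <= _); last by rewrite ler_pM2l.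
rewrite mulr_sumr; apply: ler_sum => q /andP[/(cpart_prod cS)[h1 h2] _].
by move: al_gt0 h1; nra.
Qed.

(** * Nearly equal class sizes for r >= 3 *)

Section Balance.
Variables (S : {set V}) (t : R).
Hypotheses (r_ge3 : (3 <= r)%N) (cS : clique E2 S) (sS : #|S| = r).
Hypothesis miss :
  \sum_(q : V * V | cross E2 S q.1 q.2 && ~~ E2 q.1 q.2) (x q.1 * x q.2) ^+ 2 <= eta.
Hypothesis var : forall u, u \in S -> (mass p (cpart E2 S u) - r%:R^-1) ^+ 2 <= eta.
Hypotheses (t_gt0 : 0 < t) (eta_le : eta <= t ^+ 2) (t_le : 2 * r%:R * t <= 1).

Local Notation part := (cpart E2 S).
Local Notation n u := (#|part u|%:R : R).

(** With r >= 3, [S] has two elements besides [u], and these form a triangle with [v], so single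
    weights are pinned and not only products. *)
Lemma part_vertex u v : u \in S -> v \in part u -> al <= 8 * p v /\ p v <= 8 * al.
Proof.
move=> uS /cpartP vu.
have : (1 < #|S :\ u|)%N by move: r_ge3; rewrite -sS (cardsD1 u) uS.
case/card_gt1P => a [b [aS bS ab]].
move: aS bS; rewrite !inE => /andP[au aS] /andP[bu bS].
have l0 : 0 < 2^-1 :> R by rewrite invr_gt0.
have va : E2 v a by rewrite vu.
have vb : E2 v b by rewrite vu.
have E2ab : E2 a b by move/cliqueP: cS; apply.
have /andP[h1 h2] := trunc_triangle l0 (ltr0Sn R 1) va vb E2ab.
by split; lra.
Qed.

Lemma part_card u : u \in S ->
  [/\ mass p (part u) <= 1, al * n u <= 8 & mass p (part u) <= 8 * (al * n u)].
Proof.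
move=> uS.
have m1 : mass p (part u) <= 1.
  apply: le_trans (sum_mass_cpart p_ge0 x_sum E2 S).
  rewrite (bigD1 u) //= -addrA lerDl addr_ge0 ?mass_ge0 //.
  by apply: sumr_ge0 => w _; apply: mass_ge0.
have nE : al * n u = \sum_(v in part u) al by rewrite sumr_const mulr_natr.
split=> //; rewrite nE.
  apply: (@le_trans _ _ (8 * mass p (part u))); last by move: m1; lra.
  by rewrite mulr_sumr; apply: ler_sum => v /(part_vertex uS)[].
by rewrite mulr_sumr; apply: ler_sum => v /(part_vertex uS)[].
Qed.

(** Crossing pairs in the narrow window are covered by [dev_trunc]; on the others al <= 8y gives (y
    - al)^2 <= 64 y^2, and these are few by [miss]. *)
Lemma dev_cross :
  \sum_(q : V * V | cross E2 S q.1 q.2) (x q.1 * x q.2 - al) ^+ 2 <= 65 * t ^+ 2.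
Proof.
have [D _ _] := dev_trunc.
rewrite (bigID (fun q : V * V => E2 q.1 q.2)) /=.
have h1 : \sum_(q : V * V | cross E2 S q.1 q.2 && E2 q.1 q.2)
    (x q.1 * x q.2 - al) ^+ 2 <= 9 * d.
  apply: le_trans D; apply: ler_sum_pred => [q /andP[_ /sub_trunc]//|q _].
  exact: sqr_ge0.
have h2 : \sum_(q : V * V | cross E2 S q.1 q.2 && ~~ E2 q.1 q.2)
    (x q.1 * x q.2 - al) ^+ 2 <= 64 * eta.
  apply: le_trans (_ : 64 * \sum_(q : V * V | cross E2 S q.1 q.2 && ~~ E2 q.1 q.2) (x q.1 * x q.2) ^+ 2 <= _); last by rewrite ler_pM2l.
  rewrite mulr_sumr; apply: ler_sum => q /andP[/(cpart_prod cS)[a1 a2] _].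
  have := xx0 q.1 q.2; move: al_gt0 a1 a2; nra.
apply: (le_trans (lerD h1 h2)).
have r4 : 4 <= r%:R ^+ 2 :> R by move: r2; nra.
have r4d := ler_wpM2r (ltW d_gt0) r4.
move: d_gt0 eta_le; lra.
Qed.

(** The difference is a sum of y^2 - al^2 = (y - al)(y + al) with y + al <= 9 al. By AM-GM, t al |y
    - al| <= t^2 al^2 + (y - al)^2, so t times the difference is at most 9 (64 + 65) t^2 = 1161
    t^2. *)
Lemma part_prod u u' : u \in S -> u' \in S -> u != u' ->
  mass p (part u) * mass p (part u') - al ^+ 2 * (n u * n u') <= 1161 * t /\
  al ^+ 2 * (n u * n u') - mass p (part u) * mass p (part u') <= 1161 * t.
Proof.
move=> uS u'S uu'.
pose P (q : V * V) := (q.1 \in part u) && (q.2 \in part u').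
have PE : mass p (part u) * mass p (part u') = \sum_(q | P q) (x q.1 * x q.2) ^+ 2.
  rewrite /mass big_distrlr /= pair_big_dep /=.
  by apply: eq_bigr => q _; rewrite exprMn.
have NE : al ^+ 2 * (n u * n u') = \sum_(q | P q) al ^+ 2.
  rewrite -natrM -cardsX sumr_const mulr_natr; congr (_ *+ _).
  by apply: eq_card => -[v w]; rewrite in_setX.
have Pc q : P q -> cross E2 S q.1 q.2.
  by case/andP => h1 h2; apply/crossP; exists u, u'.
have DE : \sum_(q | P q) (x q.1 * x q.2 - al) ^+ 2 <= 65 * t ^+ 2.
  by apply: le_trans dev_cross; apply: ler_sum_pred => // q _; apply: sqr_ge0.
have N64 : al ^+ 2 * (n u * n u') <= 64.
  have [_ a1 _] := part_card uS; have [_ a2 _] := part_card u'S.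
  have -> : al ^+ 2 * (n u * n u') = (al * n u) * (al * n u') by ring.
  have -> : 64 = 8 * 8 :> R by ring.
  by apply: ler_pM => //; rewrite mulr_ge0 // ltW.
(* The sign [s] treats both inequalities at once; the common factor [t] is cancelled at the end. *)
have G : forall s : R, s = 1 \/ s = -1 ->
    t * (s * (mass p (part u) * mass p (part u') - al ^+ 2 * (n u * n u'))) <= 1161 * t ^+ 2.
  move=> s hs.
  apply: (@le_trans _ _ (9 * (t ^+ 2 * (al ^+ 2 * (n u * n u')) + 65 * t ^+ 2))); last first.
    have := ler_wpM2l (sqr_ge0 t) N64; lra.
  apply: (@le_trans _ _ (9 * (t ^+ 2 * (al ^+ 2 * (n u * n u')) +
     \sum_(q | P q) (x q.1 * x q.2 - al) ^+ 2))); last by rewrite ler_pM2l // lerD2l.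
  rewrite PE NE -sumrB !mulr_sumr -big_split /= mulr_sumr.
  apply: ler_sum => q /Pc/(cpart_prod cS)[a1 a2].
  have := xx0 q.1 q.2; set y := x q.1 * x q.2 in a1 a2 * => y0.
  have [K1 K2] : t * al * (y - al) <= t ^+ 2 * al ^+ 2 + (y - al) ^+ 2 /\
     t * al * (al - y) <= t ^+ 2 * al ^+ 2 + (y - al) ^+ 2.
    by split; have := sqr_ge0 (t * al - (y - al)); have := sqr_ge0 (t * al + (y - al));
       have := sqr_ge0 (t * al); have := sqr_ge0 (y - al); nra.
  have -> : t * (s * (y ^+ 2 - al ^+ 2)) = (t * (s * (y - al))) * (y + al) by ring.
  have A0 : 0 <= t ^+ 2 * al ^+ 2 + (y - al) ^+ 2.
    by rewrite addr_ge0 ?sqr_ge0 // mulr_ge0 ?sqr_ge0.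
  have [s0|s0] := lerP 0 (t * (s * (y - al))); last first.
    apply: (@le_trans _ _ 0); last by rewrite mulr_ge0.
    by rewrite mulr_le0_ge0 ?(ltW s0) // addr_ge0 // ltW.
  apply: (@le_trans _ _ (t * (s * (y - al)) * (9 * al))).
    by rewrite ler_wpM2l //; lra.
  have -> : t * (s * (y - al)) * (9 * al) = 9 * (t * al * (s * (y - al))) by ring.
  rewrite ler_pM2l //; case: hs => ->; first by rewrite mul1r.
  by rewrite mulN1r opprB.
have G1 := G 1 (or_introl erefl); have G2 := G (-1) (or_intror erefl).
have e2 : 1161 * t ^+ 2 = t * (1161 * t) by ring.
rewrite e2 ler_pM2l // mul1r in G1; rewrite e2 ler_pM2l // mulN1r opprB in G2.
by [].
Qed.

(** Compare both classes with a third class w. The masses are within [t] of 1/r, so al^2 n_w (n_u -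
    n_u') is at most (2 * 1161 + 2) t = 2324 t, and al n_w >= 1/(16r) can be divided out. *)
Lemma part_balanced u u' : u \in S -> u' \in S ->
  al * (n u - n u') <= 16 * 2324 * r%:R * t.
Proof.
move=> uS u'S; have r0 : 0 < r%:R :> R by move: r2; lra.
have rt : 0 < r%:R * t by rewrite mulr_gt0.
have [->|uu'] := eqVneq u u'.
  by rewrite subrr mulr0; move: rt; lra.
have /card_gt0P[w] : (0 < #|S :\ u :\ u'|)%N.
  move: r_ge3; rewrite -sS (cardsD1 u) uS (cardsD1 u') !inE eq_sym uu' u'S.
  by rewrite !add1n !ltnS.
rewrite !inE => /and3P[wu' wu wS].
have [_ A] := part_prod wS uS wu; have [B _] := part_prod wS u'S wu'.
have V1 u0 : u0 \in S -> - t <= mass p (part u0) - r%:R^-1 <= t.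
  move=> u0S; rewrite -ler_norml -(ler_pXn2r (ltn0Sn 1)) ?nnegrE ?normr_ge0 ?(ltW t_gt0) //.
  by rewrite real_normK ?num_real //; apply: le_trans (var u0S) eta_le.
have /andP[v1 v2] := V1 u uS; have /andP[v3 v4] := V1 u' u'S.
have /andP[v5 v6] := V1 w wS.
have [m1 _ m2] := part_card wS.
have mw0 : 0 <= mass p (part w) by apply: mass_ge0.
have low : 1 <= 16 * r%:R * (al * n w).
  have i2t : 2 * t <= r%:R^-1.
    by rewrite -(ler_pM2l r0) rr; move: t_le; lra.
  have := ler_wpM2l (ltW r0) m2; have : r%:R * (2^-1 * r%:R^-1) <= r%:R * mass p (part w).
    by rewrite ler_pM2l //; lra.
  rewrite mulrCA rr; lra.
have main : (al * n w) * (al * (n u - n u')) <= 2324 * t.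
  have : mass p (part w) * (mass p (part u) - mass p (part u')) <= 2 * t.
    have [h|h] := lerP 0 (mass p (part u) - mass p (part u')).
      apply: (@le_trans _ _ (mass p (part u) - mass p (part u'))); last lra.
      by rewrite ler_piMl.
    apply: (@le_trans _ _ 0); last by move: t_gt0; lra.
    by rewrite mulr_ge0_le0 // ltW.
  move: A B; set a := mass p _; set b := mass p _; set b' := mass p _.
  move=> A B C; nra.
have [h|h] := lerP 0 (al * (n u - n u')); last by move: rt h; nra.
apply: le_trans (_ : 16 * r%:R * (al * n w) * (al * (n u - n u')) <= _).
  by rewrite ler_peMl.
rewrite -!mulrA; move: main; rewrite -!mulrA => main.
have := ler_wpM2l (ltW r0) main; lra.
Qed.

End Balance.
End Truncation.

(** * Equalizing the parts, and stability for test vectors *)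

Definition multipartite (V : finType) (r : nat) (P : 'I_r -> {set V}) : rel V :=
  fun v w => [exists i, exists j, [&& i != j, v \in P i & w \in P j]].

Lemma multipartiteP (V : finType) (r : nat) (P : 'I_r -> {set V}) v w :
  reflect (exists i j, [/\ i != j, v \in P i & w \in P j]) (multipartite P v w).
Proof.
apply: (iffP existsP) => [[i /existsP[j /and3P[? ? ?]]]|[i [j [? ? ?]]]].
  by exists i, j.
by exists i; apply/existsP; exists j; apply/and3P.
Qed.

Lemma subset_of_card (V : finType) (A : {set V}) k : (k <= #|A|)%N ->
  exists2 B : {set V}, B \subset A & #|B| = k.
Proof.
move=> kA; exists [set v in take k (enum A)].
  by apply/subsetP => v; rewrite inE => /mem_take; rewrite mem_enum.
rewrite cardsE (card_uniqP _) ?take_uniq ?enum_uniq // size_take -cardE.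
by case: ltngtP kA.
Qed.

Lemma card_bigcup_le (R : numDomainType) (V I : finType) (Q : I -> {set V}) (a K : R) :
  0 <= a -> (forall i, a * #|Q i|%:R <= K) ->
  a * #|\bigcup_i Q i|%:R <= #|I|%:R * K.
Proof.
move=> a0 QK.
apply: (@le_trans _ _ (a * (\sum_i #|Q i|)%N%:R)).
  rewrite ler_wpM2l // ler_nat.
  elim/big_ind2: _ => [|m A m' B h1 h2|i _]; rewrite ?cards0 //.
  by apply: leq_trans (leq_card_setU _ _) (leq_add h1 h2).
rewrite natr_sum mulr_sumr mulr_natl -sumr_const; exact: ler_sum.
Qed.

(** Cut every part down to the size of the smallest. Each destroyed pair has an end among the at
    most r K / al deleted vertices and the other among the at most r L / al vertices of all
    parts. *)
Lemma equalize_parts (R : realFieldType) (V : finType) (r : nat) (Q : 'I_r -> {set V})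
    (al K L : R) : (0 < r)%N -> 0 < al ->
  (forall i, al * #|Q i|%:R <= L) ->
  (forall i j, al * (#|Q i|%:R - #|Q j|%:R) <= K) ->
  exists P : 'I_r -> {set V}, [/\ forall i, P i \subset Q i,
    forall i j, #|P i| = #|P j| &
    al ^+ 2 *+ #|[set q : V * V | multipartite Q q.1 q.2 && ~~ multipartite P q.1 q.2]|
      <= 2 * (r%:R * K) * (r%:R * L)].
Proof.
case: r Q => // r Q _ al0 QL QK.
have [i0 _ mini] := @arg_minnP _ (ord0 : 'I_r.+1) xpredT (fun i => #|Q i|) isT.
pose k := #|Q i0|.
have ex i : {B : {set V} | (B \subset Q i) && (#|B| == k)}.
  apply: sigW; have [B sB cB] := subset_of_card (mini i isT).
  by exists B; rewrite sB cB eqxx.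
pose P i := sval (ex i).
have PQ i : P i \subset Q i by have /andP[] := svalP (ex i).
have Pk i : #|P i| = k by have /andP[_ /eqP] := svalP (ex i).
exists P; split=> //; first by move=> i j; rewrite !Pk.
pose A := \bigcup_i Q i; pose B := \bigcup_i (Q i :\: P i).
have sub : [set q : V * V | multipartite Q q.1 q.2 && ~~ multipartite P q.1 q.2] \subset
   setX B A :|: setX A B.
  apply/subsetP => -[v w]; rewrite inE /= => /andP[/multipartiteP[i [j [ij vi wj]]] np].
  have vA : v \in A by apply/bigcupP; exists i.
  have wA : w \in A by apply/bigcupP; exists j.
  rewrite !inE /= vA wA andbT /=.
  case: (boolP (v \in P i)) => vP; last first.
    by apply/orP; left; apply/bigcupP; exists i; rewrite // inE vP.
  case: (boolP (w \in P j)) => wP; last first.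
    by apply/orP; right; apply/bigcupP; exists j; rewrite // inE wP.
  by case/negP: np; apply/multipartiteP; exists i, j.
have cA : al * #|A|%:R <= r.+1%:R * L.
  by have := card_bigcup_le (ltW al0) QL; rewrite card_ord.
have cB : al * #|B|%:R <= r.+1%:R * K.
  have := @card_bigcup_le R V 'I_r.+1 (fun i => Q i :\: P i) al K (ltW al0).
  rewrite card_ord; apply=> i.
  by rewrite cardsD (setIidPr (PQ i)) natrB ?Pk ?mini //; apply: QK.
rewrite -mulr_natr.
apply: (@le_trans _ _ (al ^+ 2 * (2 * (#|A|%:R * #|B|%:R)))).
  rewrite ler_wpM2l ?sqr_ge0 // -natrM -natrM ler_nat.
  apply: leq_trans (subset_leq_card sub) _.
  by apply: leq_trans (leq_card_setU _ _) _; rewrite !cardsX mulnC mul2n addnn.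
have -> : al ^+ 2 * (2 * (#|A|%:R * #|B|%:R)) = 2 * (al * #|B|%:R) * (al * #|A|%:R) by ring.
apply: ler_pM => //.
- by rewrite !mulr_ge0 // ltW.
- by rewrite mulr_ge0 // ltW.
- by rewrite ler_pM2l.
Qed.

Lemma clique_parts (V : finType) (E : rel V) (S : {set V}) r : #|S| = r ->
  exists u : 'I_r -> V, [/\ forall i, u i \in S, injective u &
    multipartite (fun i => cpart E S (u i)) =2 cross E S].
Proof.
move=> sS; pose u (i : 'I_r) := enum_val (cast_ord (esym sS) i).
have uS i : u i \in S by apply: enum_valP.
have uinj : injective u by move=> i j /enum_val_inj/cast_ord_inj.
exists u; split=> // v w; apply/multipartiteP/crossP.
  by case=> i [j [ij vi wj]]; exists (u i), (u j); rewrite (inj_eq uinj).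
case=> a [b [aS bS ab va wb]].
pose f z (zS : z \in S) := cast_ord sS (enum_rank_in zS z).
have uf z (zS : z \in S) : u (f z zS) = z.
  by rewrite /u /f cast_ordK enum_rankK_in.
exists (f a aS), (f b bS); rewrite !uf; split=> //.
by apply: contra ab => /eqP /(congr1 u); rewrite !uf => ->.
Qed.

(** Fixes the constants: [t] is the error in class masses, [d] the spectral slack, [g] the allowed
    density of (r+1)-cliques. For r = 2 no balance is claimed, since unbalanced complete bipartite
    graphs are extremal too. *)
Theorem spectral_stability (R : realFieldType) (r : nat) (eps : R) :
  (2 <= r)%N -> 0 < eps ->
  exists d g : R, [/\ 0 < d, 0 < g & forall (V : finType) (e : rel V) (x : V -> R) (al : R),
    symmetric e -> irreflexive e ->
    (forall v, 0 <= x v) -> \sum_v x v ^+ 2 = 1 -> 0 < al ->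
    al ^+ 2 *+ #|[set q : V * V | e q.1 q.2]| <= 1 - r%:R^-1 ->
    (1 - d) * (1 - r%:R^-1) <= al * \sum_(q : V * V | e q.1 q.2) x q.1 * x q.2 ->
    (nclique e r.+1)%:R * al ^+ r.+1 <= g ->
    exists P : 'I_r -> {set V}, [/\ forall i j, i != j -> [disjoint P i & P j],
      (3 <= r)%N -> forall i j, #|P i| = #|P j| &
      al ^+ 2 *+ (#|[set q : V * V | e q.1 q.2 && ~~ multipartite P q.1 q.2]|
               + #|[set q : V * V | multipartite P q.1 q.2 && ~~ e q.1 q.2]|) <= eps]].
Proof.
move=> r2 eps0.
have r0 : 2 <= r%:R :> R by rewrite ler_nat.
pose eps1 := Num.min eps 1.
have e1 : 0 < eps1 by rewrite lt_min eps0 ltr01.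
have e11 : eps1 <= 1 by rewrite ge_min lexx orbT.
have e1e : eps1 <= eps by rewrite ge_min lexx.
have r3 : 8 <= r%:R ^+ 3 :> R.
  have -> : 8 = 2 ^+ 3 :> R by ring.
  by apply: lerXn2r; rewrite ?nnegrE //; lra.
(* The total error will be 67t + 256 * 2324 r^3 t, below 700000 r^3 t. *)
pose t : R := eps1 / (700 * 1000 * r%:R ^+ 3).
have den : 0 < 700 * 1000 * r%:R ^+ 3 :> R by lra.
have t0 : 0 < t by rewrite divr_gt0.
have tE : 700 * 1000 * r%:R ^+ 3 * t = eps1 by rewrite /t mulrC divfK // gt_eqF.
have rr3 : r%:R <= r%:R ^+ 3 :> R.
  by rewrite -[leLHS]expr1 ler_weXn2l //; lra.
have t1 : 2 * r%:R * t <= 1.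
  have := ler_wpM2r (ltW t0) rr3; have : 0 <= r%:R * t by rewrite mulr_ge0 ?(ltW t0).
  lra.
have tle1 : t <= 1 by have := ler_wpM2r (ltW t0) r3; lra.
(* Chosen so that the error 140 r^2 d of the partition equals t^2. *)
pose d : R := t ^+ 2 / (140 * r%:R ^+ 2).
have rsq : 4 <= r%:R ^+ 2 :> R by nra.
have den2 : 0 < 140 * r%:R ^+ 2 :> R by lra.
have dE : 140 * r%:R ^+ 2 * d = t ^+ 2 by rewrite /d mulrC divfK // gt_eqF.
have d0 : 0 < d by rewrite divr_gt0 // exprn_gt0.
have dsmall : 88 * r%:R ^+ 2 * d <= 1.
  have : t ^+ 2 <= 1 by rewrite expr_le1 // ltW.
  have : 0 <= r%:R ^+ 2 * d by rewrite mulr_ge0 ?sqr_ge0 // ltW.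
  lra.
pose rhs : R := d * (2 * r%:R)^-1 ^+ r.
have rhs0 : 0 < rhs by rewrite mulr_gt0 // exprn_gt0 // invr_gt0; lra.
(* Halving [rhs] turns the weak bound on cliques into the strict one required. *)
pose g : R := rhs / 2 / (r.+1)`!%:R * (d ^+ 3) ^+ r.+1.
have f0 : 0 < (r.+1)`!%:R :> R by rewrite ltr0n fact_gt0.
have d30 : 0 < (d ^+ 3) ^+ r.+1 by rewrite !exprn_gt0.
have g0 : 0 < g by rewrite mulr_gt0 // !divr_gt0.
exists d, g; split=> // V e x al sym irr x0 x1 al0 arcs ray few.
have few' : (r.+1)`!%:R * ((nclique e r.+1)%:R * (al / d ^+ 3) ^+ r.+1)
    < d * (2 * r%:R)^-1 ^+ r.
  rewrite -/rhs; apply: (@le_lt_trans _ _ (rhs / 2)); last by lra.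
  rewrite expr_div_n mulrA mulrA ler_pdivrMr // -mulrA mulrC -ler_pdivlMr //.
  apply: (le_trans few); rewrite /g le_eqVlt; apply/orP; left; apply/eqP; ring.
have [S [cS sS X Y var]] := exists_partition sym irr x0 x1 al0 r2 d0 dsmall arcs ray few'.
have [D1 D2] := sym_diff_le sym irr x0 x1 al0 r2 d0 dsmall arcs ray few' cS X Y.
have [u [uS uinj uE]] := clique_parts (trunc e x al 2^-1 2) sS.
set E := trunc e x al 2^-1 2 in cS D1 D2 X Y var uE.
rewrite dE in D1 D2 Y var.
have tt : t ^+ 2 <= t by rewrite expr2 ler_piMl // ltW.
have disj i j : i != j -> [disjoint cpart E S (u i) & cpart E S (u j)].
  move=> ij; rewrite -setI_eq0; apply/eqP/setP => v; rewrite !in_set0; apply/negP.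
  case/setIP => vi vj; case/negP: ij; apply/eqP/uinj; exact: cpart_eq vi vj.
have sumE (P : pred (V * V)) : \sum_(q | P q) al ^+ 2 = al ^+ 2 *+ #|[set q | P q]|.
  by rewrite sumr_const; congr (_ *+ _); apply: eq_card => q; rewrite inE.
rewrite !sumE in D1 D2.
have D : al ^+ 2 *+ (#|[set q : V * V | e q.1 q.2 && ~~ cross E S q.1 q.2]|
               + #|[set q : V * V | cross E S q.1 q.2 && ~~ e q.1 q.2]|) <= 67 * t.
  by rewrite mulrnDr; apply: (le_trans (lerD D1 D2)); lra.
have tr3 : 8 * t <= r%:R ^+ 3 * t by rewrite ler_pM2r.
have [r3'|r3'] := leqP 3 r; last first.
  exists (fun i => cpart E S (u i)); split; [exact: disj|by []|].
  apply: le_trans (_ : 67 * t <= _); last by lra.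
  apply: le_trans D; rewrite le_eqVlt; apply/orP; left; apply/eqP.
  by congr (_ *+ (_ + _)); apply: eq_card => q; rewrite !inE uE.
have etale : 140 * r%:R ^+ 2 * d <= t ^+ 2 by rewrite dE.
have Y' : \sum_(q | cross E S q.1 q.2 && ~~ E q.1 q.2) (x q.1 * x q.2) ^+ 2 <= 140 * r%:R ^+ 2 * d.
  by rewrite dE.
have var' w : w \in S -> (mass (fun v => x v ^+ 2) (cpart E S w) - r%:R^-1) ^+ 2 <= 140 * r%:R ^+ 2 * d.
  by rewrite dE; apply: var.
have QL i : al * #|cpart E S (u i)|%:R <= 8.
  by have [] := part_card x1 al0 r3' cS sS (uS i).
have QK i j : al * (#|cpart E S (u i)|%:R - #|cpart E S (u j)|%:R) <= 16 * 2324 * r%:R * t.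
  exact: (part_balanced sym irr x0 x1 al0 r2 d0 dsmall arcs ray few' r3' cS sS Y' var' t0 etale t1 (uS i) (uS j)).
have [P [PQ Peq Pd]] := equalize_parts (ltnW r2) al0 QL QK.
exists P; split=> //.
  by move=> i j ij; apply: disjointW (PQ i) (PQ j) (disj i j ij).
(* The first term is the distance to the classes, the second the price of making them equal. *)
apply: (@le_trans _ _ (67 * t + 2 * (r%:R * (16 * 2324 * r%:R * t)) * (r%:R * 8))); last first.
  have -> : 2 * (r%:R * (16 * 2324 * r%:R * t)) * (r%:R * 8) = 256 * 2324 * (r%:R ^+ 3 * t) by ring.
  lra.
apply: le_trans (lerD D Pd); rewrite -mulrnDr ler_wpMn2l ?sqr_ge0 // addnAC leq_add //.
  apply: leq_trans (leq_card_setU _ _); apply: subset_leq_card; apply/subsetP => q.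
  rewrite !inE uE => /andP[-> np]; rewrite np andbT /=; exact: orNb.
apply: subset_leq_card; apply/subsetP => q; rewrite !inE => /andP[/multipartiteP[i [j [ij vi wj]]] ->].
rewrite andbT -uE; apply/multipartiteP; exists i, j; split=> //.
  exact: (subsetP (PQ i)).
exact: (subsetP (PQ j)).
Qed.

(** * Supersaturation *)

Section Averages.
Variable R : realFieldType.

Definition avg (I : finType) (F : I -> R) : R := (\sum_i F i) / #|I|%:R.

Lemma ler_avg (I : finType) (F G : I -> R) :
  (forall i, F i <= G i) -> avg F <= avg G.
Proof.
by move=> FG; rewrite ler_wpM2r ?invr_ge0 //; apply: ler_sum => i _; apply: FG.
Qed.

Lemma avg_ge0 (I : finType) (F : I -> R) : (forall i, 0 <= F i) -> 0 <= avg F.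
Proof. by move=> F0; rewrite mulr_ge0 ?invr_ge0 //; apply: sumr_ge0. Qed.

Lemma eq_avg (I : finType) (F G : I -> R) : F =1 G -> avg F = avg G.
Proof. by move=> FG; congr (_ / _); apply: eq_bigr => i _; apply: FG. Qed.

Lemma avg_exchange (I J : finType) (F : I -> J -> R) :
  avg (fun i => avg (F i)) = avg (fun j => avg (fun i => F i j)).
Proof.
by rewrite /avg -!mulr_suml exchange_big /= -!mulrA [_^-1 * _]mulrC.
Qed.

(** Chebyshev's sum inequality: [a i - a j] and [a i ^+ k - a j ^+ k] have the same sign. *)
Lemma chebyshev_sum (I : finType) (a : I -> R) k : (forall i, 0 <= a i) ->
  (\sum_i a i) * (\sum_i a i ^+ k) <= #|I|%:R * \sum_i a i ^+ k.+1.
Proof.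
move=> a0.
have H : 0 <= \sum_i \sum_j (a i - a j) * (a i ^+ k - a j ^+ k).
  apply: sumr_ge0 => i _; apply: sumr_ge0 => j _.
  have [ij|ij] := lerP (a i) (a j).
    by apply: mulr_le0; rewrite subr_le0 // lerXn2r ?nnegrE.
  by apply: mulr_ge0; rewrite subr_ge0 ?lerXn2r ?nnegrE // ltW.
have E : \sum_i \sum_j (a i - a j) * (a i ^+ k - a j ^+ k) =
   2 * (#|I|%:R * \sum_i a i ^+ k.+1) - 2 * ((\sum_i a i) * (\sum_i a i ^+ k)).
  rewrite (eq_bigr (fun i => #|I|%:R * a i ^+ k.+1 + \sum_j a j ^+ k.+1 -
     (a i * \sum_j a j ^+ k + (\sum_j a j) * a i ^+ k))).
    by rewrite sumrB !big_split /= -!mulr_sumr -!mulr_suml sumr_const -[(\sum_i _) *+ _]mulr_natl; ring.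
  move=> i _; rewrite mulr_sumr mulr_suml -[#|I|%:R]sumr_const mulr_suml -!big_split /= -sumrB.
  by apply: eq_bigr => j _; rewrite !exprS; ring.
rewrite E in H; lra.
Qed.

Lemma power_mean (I : finType) (a : I -> R) k : (0 < #|I|)%N ->
  (forall i, 0 <= a i) -> avg a ^+ k <= avg (fun i => a i ^+ k).
Proof.
move=> I0 a0; have n0 : 0 < #|I|%:R :> R by rewrite ltr0n.
elim: k => [|k IH].
  by rewrite /avg expr0 sumr_const divff // gt_eqF.
rewrite exprS; apply: (@le_trans _ _ (avg a * avg (fun i => a i ^+ k))).
  by rewrite ler_wpM2l ?avg_ge0.
rewrite /avg mulrACA -invfM ler_pdivrMr ?mulr_gt0 // -mulrA mulKf ?gt_eqF //.
by rewrite [leRHS]mulrC; apply: chebyshev_sum.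
Qed.

Lemma avg_tuple0 (T : finType) (h : seq T -> R) :
  avg (fun l : 0.-tuple T => h l) = h [::].
Proof.
rewrite /avg card_tuple expn0 divr1 (big_pred1 [tuple]) // => l.
by apply/esym/eqP/val_inj; case: l => -[].
Qed.

Lemma avg_tupleS (T : finType) s (h : seq T -> R) :
  avg (fun l : s.+1.-tuple T => h l) =
  avg (fun x : T => avg (fun l : s.-tuple T => h (x :: l))).
Proof.
rewrite /avg -mulr_suml -mulrA !card_tuple -invfM -natrM mulnC -expnS; congr (_ / _).
rewrite pair_big /= (reindex (fun q : T * s.-tuple T => [tuple of q.1 :: q.2])) //=.
exists (fun l => (thead l, [tuple of behead l])) => [[x l] _|l _] /=.
  by congr (_, _); apply: val_inj.
by rewrite [RHS]tuple_eta.
Qed.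

End Averages.

(** * Homomorphisms from blow-ups of a clique *)

Section BlowUp.
Variables (R : realFieldType) (T K : finType).
Hypotheses (T_gt0 : (0 < #|T|)%N).

(** The product of [h] over all transversals, that is, all choices of one value from each family in
    [Xs]. If [h] is the clique indicator, it tests whether the families span a blow-up of a
    clique. *)
Fixpoint blow (Xs : seq {ffun K -> T}) (h : seq T -> R) : R :=
  if Xs is X :: Xs' then blow Xs' (fun l => \prod_(v : K) h (X v :: l))
  else h [::].

(** One coordinate at a time: its [#|K|] copies are independent once the other coordinates are
    fixed, so power means apply; each coordinate multiplies the exponent by [#|K|]. *)
Lemma blow_lower s (h : seq T -> R) : (forall l, 0 <= h l) ->
  avg (fun l : s.-tuple T => h l) ^+ (#|K| ^ s) <=
  avg (fun Xs : s.-tuple {ffun K -> T} => blow Xs h).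
Proof.
elim: s h => [|s IH] h h0.
  by rewrite (avg_tuple0 (fun Xs => blow Xs h)) avg_tuple0 expn0 expr1.
rewrite (avg_tupleS s (fun Xs => blow Xs h)) avg_tupleS /=.
pose hX (X : {ffun K -> T}) l := \prod_v h (X v :: l).
have hX0 X l : 0 <= hX X l by apply: prodr_ge0.
have F0 : (0 < #|{ffun K -> T}|)%N by rewrite card_ffun expn_gt0 T_gt0.
apply: le_trans (_ : avg (fun X => avg (fun l : s.-tuple T => hX X l) ^+ (#|K| ^ s)) <= _);
  last by apply: ler_avg => X; apply: IH.
apply: le_trans (power_mean _ F0 _); last by move=> X; apply: avg_ge0.
rewrite expnS exprM; apply: lerXn2r; rewrite ?nnegrE ?exprn_ge0 ?avg_ge0 //.
- by move=> x; apply: avg_ge0.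
- by move=> x; apply: avg_ge0.
rewrite [leRHS]avg_exchange avg_exchange.
have E (l : s.-tuple T) : avg (fun X => hX X l) = avg (fun x => h (x :: l)) ^+ #|K|.
  rewrite /avg /hX card_ffun natrX expr_div_n; congr (_ / _).
  by rewrite -(bigA_distr_bigA (fun (_ : K) x => h (x :: l))) prodr_const.
rewrite (eq_avg E); case: (posnP #|{: s.-tuple T}|) => [c0|c0].
  by move: c0; rewrite card_tuple => /eqP; rewrite expn_eq0 (gtn_eqF T_gt0).
by apply: power_mean => // l; apply: avg_ge0.
Qed.

(** A product of factors in [0,1] is at most any one of them; [sel] names the transversal kept. *)
Lemma blow_upper (Xs : seq {ffun K -> T}) (sel : seq K) (h : seq T -> R) :
  (forall l, 0 <= h l <= 1) -> size sel = size Xs ->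
  blow Xs h <= h [seq q.1 q.2 | q : {ffun K -> T} * K <- zip Xs sel].
Proof.
elim: Xs sel h => [|X Xs IH] [|a sel] h h01 //= [sz].
apply: le_trans (IH sel _ _ sz) _ => [l|].
  by rewrite prodr_ge0 ?prodr_ile1 // => v _; case/andP: (h01 (X v :: l)).
rewrite (bigD1 a) //= ler_piMr ?prodr_ile1 //.
by case/andP: (h01 (X a :: [seq q.1 q.2 | q : {ffun K -> T} * K <- zip Xs sel])).
Qed.

Variables (A : rel T) (eK : rel K) (s : nat) (c : K -> 'I_s).
Hypotheses (A_sym : symmetric A) (c_proper : forall u v, eK u v -> c u != c v).

Definition homs : {set {ffun K -> T}} :=
  [set phi : {ffun K -> T} | [forall u, forall v, eK u v ==> A (phi u) (phi v)]].

(** Each vertex of [K] is placed in the family of its own colour. *)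
Definition diag (Xs : s.-tuple {ffun K -> T}) : {ffun K -> T} :=
  [ffun v => tnth Xs (c v) v].

Local Notation hA := (fun l : seq T => (pairwise A l)%:R : R).

(** An edge u v not respected by [diag Xs] gives a transversal that is not a clique, hence a zero
    factor. *)
Lemma blow_diag (Xs : s.-tuple {ffun K -> T}) : blow Xs hA <= (diag Xs \in homs)%:R.
Proof.
have h01 (l : seq T) : 0 <= hA l <= 1 by case: (pairwise A l); rewrite ?lexx ?ler01.
case: (boolP (diag Xs \in homs)) => [_|].
  case: (pickP (@predT K)) => [a _|K0].
    apply: le_trans (blow_upper (sel := nseq s a) h01 _) _; first by rewrite size_nseq size_tuple.
    by case: pairwise.
  (* If [K] is empty there is no selection to make, and all products are empty. *)
  have aux (Ys : seq {ffun K -> T}) h : (forall l, h l <= 1) -> blow Ys h <= 1.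
    elim: Ys h => [|Y Ys IH] h h1 //=.
    by apply: IH => l; rewrite big_pred0.
  by apply: aux => l; case/andP: (h01 l).
rewrite inE negb_forall => /existsP[u]; rewrite negb_forall => /existsP[v].
rewrite negb_imply !ffunE => /andP[uv nA].
have cuv := c_proper uv.
(* Only the positions [c u] and [c v] matter; they differ because the colouring is proper. *)
pose sel := [tuple if i == c u then u else v | i < s].
apply: le_trans (blow_upper (sel := sel) h01 _) _; first by rewrite !size_tuple.
set l := map _ _.
suff -> : pairwise A l = false by [].
apply: contraNF nA => /pairwiseP pw.
have sz : size l = s by rewrite size_map size1_zip ?size_tuple.
have lE (i : 'I_s) : nth (tnth Xs i (tnth sel i)) l i = tnth Xs i (tnth sel i).
  rewrite (nth_map (tnth Xs i, tnth sel i)) ?size1_zip ?size_tuple //.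
  by rewrite nth_zip ?size_tuple //= [in RHS](tnth_nth (tnth Xs i)) [in RHS](tnth_nth (tnth sel i)).
have lu (x0 : T) : nth x0 l (c u) = tnth Xs (c u) u.
  by rewrite (set_nth_default (tnth Xs (c u) (tnth sel (c u)))) ?sz // lE tnth_mktuple eqxx.
have lv (x0 : T) : nth x0 l (c v) = tnth Xs (c v) v.
  rewrite (set_nth_default (tnth Xs (c v) (tnth sel (c v)))) ?sz // lE tnth_mktuple.
  by rewrite eq_sym (negbTE cuv).
pose x0 := tnth Xs (c u) u.
have := pw x0 (c u) (c v); have := pw x0 (c v) (c u); rewrite lu lv !inE sz !ltn_ord.
case: (ltngtP (c u) (c v)) => [_ _|_|/val_inj E].
- exact.
- by rewrite A_sym => H _; apply: H.
- by rewrite E eqxx in cuv.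
Qed.

(** [diag] of a uniform tuple is a uniform map: overwriting the diagonal entries by [psi] while
    recording the old ones loses nothing, which gives the injection. *)
Lemma card_diag_homs :
  (#|[set Xs : s.-tuple {ffun K -> T} | diag Xs \in homs]| * #|{ffun K -> T}|
    <= #|homs| * #|{: s.-tuple {ffun K -> T}}|)%N.
Proof.
pose D := [set Xs : s.-tuple {ffun K -> T} | diag Xs \in homs].
pose upd (q : s.-tuple {ffun K -> T} * {ffun K -> T}) : s.-tuple {ffun K -> T} :=
  [tuple [ffun v => if i == c v then q.2 v else tnth q.1 i v] | i < s].
rewrite -cardsT -[X in (_ <= _ * X)%N]cardsT -!cardsX.
rewrite -(card_in_imset (f := fun q => (diag q.1, upd q))).
  apply: subset_leq_card; apply/subsetP => y /imsetP[[Xs psi] /setXP[h _] ->].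
  by apply/setXP; split; [rewrite inE in h|rewrite inE].
move=> [Xs psi] [Ys psi'] _ _ E.
have dE : diag Xs = diag Ys := congr1 fst E.
have uE : upd (Xs, psi) = upd (Ys, psi') := congr1 snd E.
congr (_, _).
  apply: eq_from_tnth => i; apply/ffunP => v.
  have := congr1 (fun t : s.-tuple {ffun K -> T} => tnth t i v) uE; rewrite !tnth_mktuple !ffunE.
  case: eqP => // -> _; have := congr1 (fun f : {ffun K -> T} => f v) dE.
  by rewrite !ffunE.
apply/ffunP => v; have := congr1 (fun t : s.-tuple {ffun K -> T} => tnth t (c v) v) uE.
by rewrite !tnth_mktuple !ffunE eqxx.
Qed.

Lemma homs_lower :
  avg (fun l : s.-tuple T => hA l) ^+ (#|K| ^ s) <= #|homs|%:R / #|T|%:R ^+ #|K|.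
Proof.
apply: le_trans (blow_lower s _) _; first by move=> l; rewrite ler0n.
apply: le_trans (ler_avg (fun Xs => blow_diag Xs)) _.
have T0 : 0 < #|T|%:R :> R by rewrite ltr0n.
have F0 : (0 < #|{ffun K -> T}|)%N by rewrite card_ffun expn_gt0 T_gt0.
have := card_diag_homs; rewrite -(ler_nat R) !natrM => H.
rewrite /avg -natrX -card_ffun ler_pdivrMr; last first.
  by rewrite ltr0n card_tuple expn_gt0 F0.
rewrite mulrAC ler_pdivlMr ?ltr0n //; apply: le_trans H.
rewrite ler_wpM2r // -natr_sum ler_nat -sum1_card big_mkcond /=.
rewrite [X in (_ <= X)%N]big_mkcond /=; apply: leq_sum => Xs _.
by rewrite [X in if X then _ else _]in_set; case: (_ \in homs).
Qed.

(** Union bound over colliding pairs u, v: such a map may have its value at u replaced freely, the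
    old one being recovered from v. *)
Lemma noninj_upper :
  (#|[set phi : {ffun K -> T} | ~~ injectiveb phi]| * #|T| <= #|K| ^ 2 * #|T| ^ #|K|)%N.
Proof.
pose B (q : K * K) := [set phi : {ffun K -> T} | (q.1 != q.2) && (phi q.1 == phi q.2)].
have cB q : (#|B q| * #|T| <= #|T| ^ #|K|)%N.
  case: q => u v; rewrite /B /=; case: (eqVneq u v) => [_|uv] /=.
    by rewrite (_ : [set _ | _] = set0) ?cards0 //; apply/setP => phi; rewrite !inE.
  rewrite -card_ffun -cardsT -[X in (_ <= X)%N]cardsT -cardsX.
  pose f (q : {ffun K -> T} * T) := [ffun w => if w == u then q.2 else q.1 w] : {ffun K -> T}.
  rewrite -(card_in_imset (f := f)); first exact/subset_leq_card/subsetT.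
  move=> [phi a] [psi b] /setXP[]; rewrite inE => /eqP E1 _ /setXP[].
  rewrite inE => /eqP E2 _ /ffunP fE; congr (_, _); last first.
    by have := fE u; rewrite !ffunE eqxx.
  have off w : w != u -> phi w = psi w.
    by move=> wu; have := fE w; rewrite !ffunE (negbTE wu).
  apply/ffunP => w; case: (eqVneq w u) => [->|/off//].
  by rewrite E1 E2 off // eq_sym.
apply: (@leq_trans ((\sum_q #|B q|) * #|T|)).
  rewrite leq_mul2r; apply/orP; right.
  apply: (@leq_trans #|\bigcup_q B q|).
    apply: subset_leq_card; apply/subsetP => phi; rewrite inE => /injectivePn[u [v uv E]].
    by apply/bigcupP; exists (u, v); rewrite // inE /= uv E eqxx.
  elim/big_ind2: _ => [|m X m' Y h1 h2|i _]; rewrite ?cards0 //.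
  by apply: leq_trans (leq_card_setU _ _) (leq_add h1 h2).
rewrite big_distrl /=; apply: leq_trans (leq_sum _ (fun q _ => cB q)) _.
by rewrite sum_nat_const card_prod mulnn.
Qed.

End BlowUp.

Lemma leq_bin_exp n k : ('C(n, k) <= n ^ k)%N.
Proof.
apply: (@leq_trans (n ^_ k)); first by rewrite -bin_ffact leq_pmulr ?fact_gt0.
elim: k => // k IH; by rewrite ffactnSr expnSr; apply: leq_mul => //; apply: leq_subr.
Qed.

(** * Cliques in graphs with few edges *)

Section SparseCliques.
Variables (R : realFieldType) (V : finType) (e : rel V).
Hypotheses (sym : symmetric e) (irr : irreflexive e).

Definition deg (v : V) : nat := #|[set w | e v w]|.

Lemma sum_deg : (\sum_v deg v = #|[set q : V * V | e q.1 q.2]|)%N.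
Proof.
rewrite -sum1_card [RHS]big_mkcond /=.
rewrite [RHS](eq_bigr (fun q : V * V => (e q.1 q.2 : nat))); last first.
  by move=> q _; rewrite inE; case: (e _ _).
rewrite -(pair_bigA _ (fun v w => (e v w : nat))) /=.
apply: eq_bigr => v _; rewrite /deg -sum1_card [LHS]big_mkcond /=.
by apply: eq_bigr => w _; rewrite inE; case: (e _ _).
Qed.

(** A clique leaving [W] consists of some v outside [W] and [s] of its neighbours. *)
Lemma low_cliques (W : {set V}) s :
  (#|[set S : {set V} | [&& clique e S, #|S| == s.+1 & ~~ (S \subset W)]]|
     <= \sum_(v | v \notin W) deg v ^ s)%N.
Proof.
pose nb v := [set w | e v w].
pose Bs v := [set v |: B | B in [set B : {set V} | B \subset nb v & #|B| == s]].
apply: (@leq_trans #|\bigcup_(v | v \notin W) Bs v|).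
  apply: subset_leq_card; apply/subsetP => S; rewrite inE.
  case/and3P => /cliqueP cS /eqP sS /subsetPn[v vS vW].
  apply/bigcupP; exists v => //; apply/imsetP; exists (S :\ v); last by rewrite setD1K.
  rewrite inE; apply/andP; split; last first.
    by move: sS; rewrite (cardsD1 v) vS add1n => -[->].
  apply/subsetP => w; rewrite !inE => /andP[wv wS]; apply: cS => //.
  by rewrite eq_sym.
apply: (@leq_trans (\sum_(v | v \notin W) #|Bs v|)).
  elim/big_ind2: _ => [|m X m' Y h1 h2|i _]; rewrite ?cards0 //.
  by apply: leq_trans (leq_card_setU _ _) (leq_add h1 h2).
apply: leq_sum => v _; apply: leq_trans (leq_imset_card _ _) _.
by rewrite cards_draws leq_bin_exp.
Qed.

(** Of the s - 1 factors deg v, one is summed to the number of arcs and the other s - 2 are below h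
    N. As s >= 3, at least one factor h is gained. *)
Lemma low_cliques_real (N h : R) s : (3 <= s)%N -> 0 < N -> 0 < h -> h <= 1 ->
  #|[set q : V * V | e q.1 q.2]|%:R <= 2 * N ^+ 2 ->
  #|[set S : {set V} | [&& clique e S, #|S| == s &
      ~~ (S \subset [set v | h * N <= (deg v)%:R])]]|%:R
    <= 2 * h * N ^+ s.
Proof.
case: s => [|[|[|s]]] // _ N0 h0 h1 arcs; set W := [set v | _].
have hN : 0 < h * N by rewrite mulr_gt0.
have := low_cliques W s.+2; rewrite -(ler_nat R) => /le_trans; apply.
rewrite natr_sum; apply: (@le_trans _ _ (\sum_v (deg v)%:R * (h * N) ^+ s.+1)).
  rewrite big_mkcond /=; apply: ler_sum => v _; case: ifP; last first.
    by move=> _; rewrite mulr_ge0 // exprn_ge0 // ltW.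
  rewrite inE -ltNge => dv; rewrite natrX exprS ler_wpM2l //.
  by apply: lerXn2r; rewrite ?nnegrE // ltW.
rewrite -mulr_suml -natr_sum sum_deg.
apply: (@le_trans _ _ (2 * N ^+ 2 * (h * N) ^+ s.+1)).
  by rewrite ler_wpM2r // exprn_ge0 // ltW.
rewrite exprMn.
have hh : h ^+ s.+1 <= h by rewrite -[leRHS]expr1 ler_wiXn2l // ltW.
have -> : 2 * N ^+ 2 * (h ^+ s.+1 * N ^+ s.+1) = h ^+ s.+1 * (2 * N ^+ s.+3).
  by rewrite -[s.+3]add2n exprD; ring.
have -> : 2 * h * N ^+ s.+3 = h * (2 * N ^+ s.+3) by ring.
by rewrite ler_wpM2r // mulr_ge0 // exprn_ge0 // ltW.
Qed.

Lemma high_degree_card (N h : R) : 0 < N -> 0 < h ->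
  #|[set q : V * V | e q.1 q.2]|%:R <= 2 * N ^+ 2 ->
  #|[set v | h * N <= (deg v)%:R]|%:R <= 2 / h * N.
Proof.
move=> N0 h0 arcs; rewrite mulrAC ler_pdivlMr // -(ler_pM2r N0) -[leLHS]mulrA -[leRHS]mulrA -expr2.
apply: le_trans arcs; rewrite -sum_deg natr_sum mulr_natl -sumr_const.
rewrite big_mkcond /=; apply: ler_sum => v _; rewrite inE.
by case: ifP.
Qed.

Lemma cliques_in_le_tuples (W : {set V}) s :
  (#|[set S : {set V} | [&& clique e S, #|S| == s & S \subset W]]| <=
   #|[set l : s.-tuple {v : V | v \in W} | pairwise (fun a b => e (val a) (val b)) l]|)%N.
Proof.
set L := [set l : s.-tuple _ | _].
pose st (l : s.-tuple {v : V | v \in W}) : {set V} := [set val a | a in l].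
apply: (@leq_trans #|st @: L|); last exact: leq_imset_card.
apply: subset_leq_card; apply/subsetP => S; rewrite inE.
case/and3P => /cliqueP cS /eqP sS /subsetP SW.
pose l0 : seq {v : V | v \in W} := pmap insub (enum S).
have l0E : map val l0 = enum S.
  rewrite /l0 (pmap_filter (insubK _)); apply/all_filterP/allP => v.
  by rewrite mem_enum => /SW vW; rewrite /= insubT.
have sz : size l0 == s by rewrite -(size_map val) l0E -cardE sS.
apply/imsetP; exists (Tuple sz); last first.
  apply/setP => v; rewrite -mem_enum -l0E; apply/mapP/imsetP => -[a al ->]; by exists a.
rewrite inE /=.
have : uniq l0 by rewrite -(map_inj_uniq val_inj) l0E enum_uniq.
rewrite uniq_pairwise; apply: sub_in_pairwise (_ : all (fun a => val a \in S) l0).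
  by move=> a b aS bS /= ab; apply: cS.
by apply/allP => a al; rewrite -mem_enum -l0E map_f.
Qed.

End SparseCliques.

Definition inj_homs (K V : finType) (eK : rel K) (e : rel V) : {set {ffun K -> V}} :=
  [set phi : {ffun K -> V} | injectiveb phi &&
     [forall u, forall v, eK u v ==> e (phi u) (phi v)]].

(** Most s-cliques lie on the O(N) vertices of degree at least h N, where they have positive
    density. There [homs_lower] gives a positive proportion of all maps, and the non-injective ones
    are of lower order. *)
Theorem sparse_supersaturation (R : realFieldType) (K : finType) (eK : rel K)
    (s : nat) (c : K -> 'I_s) (g : R) :
  (3 <= s)%N -> (forall u v, eK u v -> c u != c v) -> 0 < g ->
  exists c' N0 : R, 0 < c' /\ forall (V : finType) (e : rel V) (N : R),
    symmetric e -> irreflexive e -> 0 < N -> N0 <= N ->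
    #|[set q : V * V | e q.1 q.2]|%:R <= 2 * N ^+ 2 ->
    g * N ^+ s <= (nclique e s)%:R ->
    c' * N ^+ #|K| <= #|inj_homs eK e|%:R.
Proof.
move=> s3 cp g0.
pose g1 := Num.min g 1.
have g10 : 0 < g1 by rewrite lt_min g0 ltr01.
have g11 : g1 <= 1 by rewrite ge_min lexx orbT.
have g1g : g1 <= g by rewrite ge_min lexx.
(* Cliques through low degrees number at most 2h N^s = (g1 / 2) N^s, which leaves b N^s. *)
pose h : R := g1 / 4; pose b : R := g1 / 2.
have h0 : 0 < h by rewrite divr_gt0.
have h1 : h <= 1 by rewrite /h; lra.
have b0 : 0 < b by rewrite divr_gt0.
have b1 : b <= 1 by rewrite /b; lra.
(* Density of cliques among [s]-tuples of high-degree vertices, of which there are at most (2 / h)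
   N. *)
pose d0 : R := b * (h / 2) ^+ s.
have d00 : 0 < d0 by rewrite mulr_gt0 // exprn_gt0 // divr_gt0.
pose d1 : R := d0 ^+ (#|K| ^ s).
have d10 : 0 < d1 by rewrite exprn_gt0.
exists (d1 / 2 * b ^+ #|K|), (2 * #|K|%:R ^+ 2 / d1 / b).
split; first by rewrite mulr_gt0 ?exprn_gt0 // divr_gt0.
move=> V e N sym irr N0 NN0 arcs ncl.
pose W := [set v | h * N <= (deg e v)%:R].
have low := low_cliques_real s3 N0 h0 h1 arcs.
rewrite -/W in low.
have Wle := high_degree_card N0 h0 arcs; rewrite -/W in Wle.
have Ns : 0 < N ^+ s by rewrite exprn_gt0.
pose T : finType := {v : V | v \in W}.
pose A : rel T := fun a b => e (val a) (val b).
have cT : #|T| = #|W| by rewrite card_sig; apply: eq_card => v; rewrite inE.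
pose L := [set l : s.-tuple T | pairwise A l].
have Lge : b * N ^+ s <= #|L|%:R.
  have : (nclique e s <= #|L| +
     #|[set S : {set V} | [&& clique e S, #|S| == s & ~~ (S \subset W)]]|)%N.
    apply: leq_trans (leq_add (cliques_in_le_tuples e W s) (leqnn _)).
    apply: leq_trans (leq_card_setU _ _); apply: subset_leq_card; apply/subsetP => S.
    by rewrite !inE; case: (S \subset W) => /andP[-> ->].
  rewrite -(ler_nat R) natrD => H.
  have := ler_wpM2r (ltW Ns) g1g; rewrite /b; rewrite /h in low.
  set x := N ^+ s in low ncl Ns *; lra.
have avgE : avg (fun l : s.-tuple T => (pairwise A l)%:R : R) = #|L|%:R / #|T|%:R ^+ s.
  rewrite /avg card_tuple natrX; congr (_ / _).
  rewrite -natr_sum; congr _%:R; rewrite -sum1_card [RHS]big_mkcond /=.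
  by apply: eq_bigr => l _; rewrite inE; case: pairwise.
have Lle : (#|L| <= #|T| ^ s)%N.
  by rewrite -card_tuple; apply: max_card.
(* There must be many high-degree vertices, since |T|^s tuples hold b N^s cliques and b^s <= b. *)
have nb : b * N <= #|T|%:R.
  rewrite leNgt; apply/negP => lt.
  have : #|T|%:R ^+ s < (b * N) ^+ s.
    by rewrite ltr_pXn2r ?nnegrE ?(leq_trans _ s3) // mulr_ge0 // ltW.
  apply/negP; rewrite -leNgt exprMn.
  apply: le_trans (_ : b * N ^+ s <= _).
    rewrite ler_pM2r // -[leRHS]expr1 ler_wiXn2l ?(leq_trans _ s3) //; exact: ltW.
  by apply: (le_trans Lge); rewrite -natrX ler_nat.
have T0 : 0 < #|T|%:R :> R by apply: lt_le_trans nb; rewrite mulr_gt0.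
have T0' : (0 < #|T|)%N by rewrite -(ltr0n R).
have dle : d0 <= avg (fun l : s.-tuple T => (pairwise A l)%:R : R).
  rewrite avgE ler_pdivlMr ?exprn_gt0 //; apply: le_trans Lge.
  rewrite /d0 -mulrA ler_pM2l // -exprMn; apply: lerXn2r; rewrite ?nnegrE ?(ltW N0) //.
    by rewrite mulr_ge0 // divr_ge0 // ltW.
  rewrite -cT in Wle.
  apply: le_trans (_ : h / 2 * (2 / h * N) <= _); first by rewrite ler_pM2l // divr_gt0.
  by rewrite mulrA mulrA divfK ?pnatr_eq0 // divff ?mul1r // gt_eqF.
have A_sym : symmetric A by move=> a a'; apply: sym.
have hom := homs_lower R T0' A_sym cp.
have {}hom : d1 * #|T|%:R ^+ #|K| <= #|homs A eK|%:R.
  rewrite -ler_pdivlMr ?exprn_gt0 //; apply: le_trans hom.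
  by apply: lerXn2r; rewrite ?nnegrE ?(ltW d00) // (le_trans _ dle) // ltW.
have non := noninj_upper T K; rewrite -(ler_nat R) natrM [leRHS]natrM !natrX in non.
have split_homs : (#|homs A eK| <= #|inj_homs eK e| +
     #|[set phi : {ffun K -> T} | ~~ injectiveb phi]|)%N.
  pose lift (phi : {ffun K -> T}) : {ffun K -> V} := [ffun u => val (phi u)].
  have liftI : injective lift.
    move=> phi psi /ffunP E; apply/ffunP => u; apply: val_inj.
    by have := E u; rewrite !ffunE.
  rewrite -(cardsID [set phi : {ffun K -> T} | injectiveb phi] (homs A eK)).
  apply: leq_add; last first.
    by apply: subset_leq_card; apply/subsetP => phi; rewrite !inE => /andP[].
  rewrite -(card_imset _ liftI); apply: subset_leq_card; apply/subsetP => y.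
  case/imsetP => phi; rewrite !inE => /andP[/'forall_forallP H /injectiveP inj] ->.
  apply/andP; split.
    by apply/injectiveP => u v; rewrite !ffunE => /val_inj/inj.
  apply/'forall_forallP => u v; rewrite !ffunE; exact: H.
have NK : 0 < N ^+ #|K| by rewrite exprn_gt0.
set X := #|inj_homs eK e| in split_homs *.
set Y := #|[set phi | ~~ _]| in non split_homs.
rewrite -(ler_nat R) natrD in split_homs.
set n : R := #|T|%:R in non T0 nb hom.
have nk : 0 < n ^+ #|K| by rewrite exprn_gt0.
have Yle : Y%:R <= d1 / 2 * n ^+ #|K|.
  rewrite -(ler_pM2r T0); apply: (le_trans non); rewrite [leRHS]mulrAC ler_pM2r //.
  rewrite -ler_pdivrMl ?divr_gt0 //; apply: le_trans nb.
  rewrite -ler_pdivrMl //; apply: le_trans NN0.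
  by rewrite le_eqVlt; apply/orP; left; apply/eqP; field; rewrite !gt_eqF.
apply: (@le_trans _ _ (d1 / 2 * n ^+ #|K|)); last by lra.
rewrite -mulrA ler_pM2l ?divr_gt0 // -exprMn; apply: lerXn2r; rewrite ?nnegrE ?(ltW T0) //.
by rewrite mulr_ge0 // ltW.
Qed.

(** * Graphs *)

Lemma set2_inj (T : finType) (a b c d : T) :
  [set a; b] = [set c; d] -> (a = c /\ b = d) \/ (a = d /\ b = c).
Proof.
move=> E.
have : a \in [set c; d] by rewrite -E set21.
have : b \in [set c; d] by rewrite -E set22.
have : c \in [set a; b] by rewrite E set21.
have : d \in [set a; b] by rewrite E set22.
rewrite !in_set2.
by do 4!(case/orP => /eqP ?); subst; auto.
Qed.

(** An arc is determined by its edge and one bit, the order of its ends under [enum_rank]. *)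
Lemma card_arcs_le (G : sgraph) :
  (#|[set q : G * G | adj q.1 q.2]| <= 2 * size_graph G)%N.
Proof.
pose f (q : G * G) := ([set q.1; q.2], (enum_rank q.1 < enum_rank q.2)%N).
rewrite -(@card_in_imset _ _ f).
  rewrite mulnC -card_bool -cardsT -cardsX.
  apply: subset_leq_card; apply/subsetP => y /imsetP[q]; rewrite inE => qa ->.
  by apply/setXP; split; rewrite ?inE //; apply/imsetP; exists q; rewrite ?inE.
move=> [a b] [c d]; rewrite !inE /= => ab cd [/set2_inj[[-> ->]//|[ac bd]]].
subst; case: ltngtP => // /val_inj/enum_rank_inj E.
by rewrite E adj_irr in cd.
Qed.

Lemma multipartite_sym (V : finType) r (P : 'I_r -> {set V}) :
  symmetric (multipartite P).
Proof.
by move=> v w; apply/multipartiteP/multipartiteP => -[i [j [ij vi wj]]];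
  exists j, i; rewrite eq_sym.
Qed.

Lemma imset2_setD (V : finType) (a b : rel V) : symmetric b ->
  [set [set q.1; q.2] | q : V * V & a q.1 q.2] :\: [set [set q.1; q.2] | q : V * V & b q.1 q.2]
  \subset [set [set q.1; q.2] | q : V * V & a q.1 q.2 && ~~ b q.1 q.2].
Proof.
move=> bs; apply/subsetP => E; rewrite inE => /andP[nE /imsetP[q]].
rewrite inE => qa EE; apply/imsetP; exists q => //; rewrite inE qa /=.
by apply: contra nE => qb; rewrite EE; apply/imsetP; exists q; rewrite ?inE.
Qed.

Lemma gdist_le (G : sgraph) r (P : 'I_r -> {set G}) :
  (gdist (graph_of G) (complete_multipartite P) <=
   #|[set q : G * G | adj q.1 q.2 && ~~ multipartite P q.1 q.2]| +
   #|[set q : G * G | multipartite P q.1 q.2 && ~~ adj q.1 q.2]|)%N.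
Proof.
apply: leq_add.
  apply: leq_trans (subset_leq_card (@imset2_setD _ (@adj G) _ (multipartite_sym P))) _.
  exact: leq_imset_card.
apply: leq_trans (subset_leq_card (@imset2_setD _ (multipartite P) _ (@adj_sym G))) _.
exact: leq_imset_card.
Qed.

Lemma complete_bipartiteE (V : finType) (P : 'I_2 -> {set V}) :
  (complete_bipartite (P ord0) (P ord_max)).2 = (complete_multipartite P).2.
Proof.
apply/setP => E; apply/imset2P/imsetP.
  case=> v w vP wP ->; exists (v, w) => //; rewrite inE; apply/multipartiteP.
  by exists ord0, ord_max.
case=> -[v w]; rewrite inE => /multipartiteP[i [j [ij vi wj]]] -> /=.
have D (k : 'I_2) : k = ord0 \/ k = ord_max.
  by case: k => -[|[|]] // h; [left|right]; apply: val_inj.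
case: (D i) ij vi => ->; case: (D j) wj => -> // wj _ vi; first exact: Imset2spec vi wj _.
by rewrite setUC; apply: Imset2spec wj vi _.
Qed.

(** All homomorphisms with the same image copy map into its [#|F|] vertices. *)
Lemma inj_homs_le_copies (F G : sgraph) :
  (#|inj_homs (@adj F) (@adj G)| <= #|F| ^ #|F| * num_copies F G)%N.
Proof.
pose im (phi : {ffun F -> G}) : {set G} * {set {set G}} :=
  (phi @: [set: F], [set phi @: E | E : {set F} in edges F]).
set C := [set H : {set G} * {set {set G}} | subgraph H (graph_of G) && is_copy F H].
have imC phi : phi \in inj_homs (@adj F) (@adj G) -> im phi \in C.
  rewrite !inE => /andP[inj /forallP hom]; apply/andP; split.
    rewrite /subgraph subsetT /=; apply/subsetP => E /imsetP[E0 /imsetP[q]].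
    rewrite inE => qa -> ->; apply/imsetP; exists (phi q.1, phi q.2).
      by rewrite inE /=; have /forallP/(_ q.2)/implyP := hom q.1; apply.
    by rewrite imsetU1 imset_set1.
  by apply/existsP; exists phi; rewrite inj !eqxx.
rewrite -sum1_card (partition_big im (fun H => H \in C)) //=.
rewrite mulnC -sum_nat_const; apply: leq_sum => H.
rewrite inE => /andP[_ /existsP[psi /and3P[/injectiveP inj /eqP H1 _]]].
have cH : #|H.1| = #|F| by rewrite H1 card_imset // cardsT.
rewrite sum1_card.
apply: (@leq_trans #|[pred phi : {ffun F -> G} | phi \in ffun_on (mem H.1)]|); last first.
  by rewrite (eq_card (B := ffun_on (mem H.1))) // card_ffun_on cH.
apply: subset_leq_card; apply/subsetP => phi.
rewrite unfold_in => /andP[_ /eqP imE]; apply/ffun_onP => v.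
by rewrite -imE /=; apply: imset_f.
Qed.

Lemma chi_colorable (F : sgraph) : colorable F (chi F).
Proof. by rewrite /chi; case: ex_minnP. Qed.

Lemma colorable_leq (F : sgraph) k s : (k <= s)%N -> colorable F k ->
  exists c : F -> 'I_s, forall u v, adj u v -> c u != c v.
Proof.
move=> ks /existsP[c /forallP H]; exists (fun u => widen_ord ks (c u)) => u v uv.
have /forallP/(_ v)/implyP/(_ uv) := H u.
by apply: contra => /eqP[] E; apply/eqP/val_inj.
Qed.

(** * Spectral radius *)

From mathcomp Require Import all_classical all_reals all_analysis.
From mathcomp Require Import complex.

Import numFieldNormedType.Exports.

Local Open Scope classical_set_scope.

(* The moduli of a complex eigenvector form a nonnegative test vector, so the
   spectral radius is reached by Rayleigh quotients without Perron-Frobenius. *)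
Lemma rho_rayleigh (R : realType) (G : sgraph) (y : R) : 0 <= y -> y < rho R G ->
  exists x : G -> R, [/\ forall v, 0 <= x v, \sum_v x v ^+ 2 = 1 &
    y <= \sum_(q : G * G | adj q.1 q.2) x q.1 * x q.2].
Proof.
move=> y0; rewrite /rho /spectral_radius; set S := (X in sup X) => yS.
(* The supremum of the empty set is 0, so 0 <= y < rho forces an eigenvalue to exist. *)
have S0 : S !=set0.
  apply/set0P; apply/negP => /eqP S0; move: yS; rewrite S0 sup0 => /(le_lt_trans y0).
  by rewrite ltxx.
have [_ [z /eigenvalueP[w wA w0] <-] yz] := sup_gt S0 yS.
pose a (i : 'I_#|G|) : R := Normc.normc (w ord0 i).
have aE i : `|w ord0 i| = (a i)%:C%C by [].
have a0 i : 0 <= a i by rewrite -(@lecR R) -aE normr_ge0.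
(* Triangle inequality in the eigenvector equation, the entries of the matrix being 0 or 1. *)
have key j : Normc.normc z * a j <= \sum_i a i * (adjmx R G) i j.
  have := congr1 (fun M => fun_of_matrix M ord0 j) wA; rewrite !mxE => E.
  rewrite -lecR rmorphM /= -[(Normc.normc z)%:C%C]/(`|z|) -aE -normrM -E.
  apply: le_trans (ler_norm_sum _ _ _) _; rewrite rmorph_sum /=.
  apply: ler_sum => i _; rewrite normrM rmorphM /= aE !mxE; apply: ler_wpM2l.
    by rewrite -aE normr_ge0.
  by case: adj; rewrite ?rmorph1 ?rmorph0 ?normr1 ?normr0.
pose n2 := \sum_i a i ^+ 2.
have n20 : 0 < n2.
  rewrite lt0r sumr_ge0 ?andbT; last by move=> i _; apply: sqr_ge0.
  apply: contra w0; rewrite psumr_eq0; last by move=> i _; apply: sqr_ge0.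
  move=> /allP H; apply/eqP/rowP => i; rewrite mxE.
  have := H i (mem_index_enum i); rewrite /= sqrf_eq0 => /eqP ai.
  exact: Normc.eq0_normc.
pose s := Num.sqrt n2.
have s0 : 0 < s by rewrite sqrtr_gt0.
have s2 : s ^+ 2 = n2 by rewrite sqr_sqrtr // ltW.
have rk : bijective (@enum_rank G) by exact: enum_rank_bij.
have n2E : n2 = \sum_v a (enum_rank v) ^+ 2.
  by rewrite /n2 (reindex _ (onW_bij _ rk)).
exists (fun v => a (enum_rank v) / s); split.
- by move=> v; rewrite divr_ge0 // ltW.
- under eq_bigr do rewrite expr_div_n.
  by rewrite -mulr_suml s2 -n2E divff // gt_eqF.
apply: (le_trans (ltW yz)).
have -> : \sum_(q : G * G | adj q.1 q.2) a (enum_rank q.1) / s * (a (enum_rank q.2) / s) =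
  (\sum_j (\sum_i a i * (adjmx R G) i j) * a j) / n2.
  rewrite -s2 -(pair_big_dep predT (fun u v => adj u v) (fun u v =>
    a (enum_rank u) / s * (a (enum_rank v) / s))) /=.
  rewrite mulr_suml (reindex _ (onW_bij _ rk)) /= (exchange_big_dep predT) //=.
  apply: eq_bigr => v _; rewrite (reindex _ (onW_bij _ rk)) /=.
  rewrite big_mkcond /= !mulr_suml; apply: eq_bigr => u _.
  rewrite mxE !enum_rankK; case: ifP => _; last by rewrite mulr0 !mul0r.
  by rewrite mulr1 expr2 invfM; ring.
rewrite ler_pdivlMr // mulr_sumr; apply: ler_sum => j _.
by rewrite expr2 mulrA; apply: ler_wpM2r.
Qed.


(** Contrapositive of supersaturation with N = sqrt m: too many s-cliques would give of order N^f
    copies of F, where f is its number of vertices and N^f = m^(f/2). *)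
Lemma few_cliques_of_few_copies (R : realType) (F : sgraph) (s : nat) (g : R)
    (G : nat -> sgraph) : (3 <= s)%N -> colorable F s -> 0 < g ->
  (forall m, size_graph (G m) = m) ->
  ((fun m => (num_copies F (G m))%:R : R^o) =o_\oo
     (fun m => (m%:R `^ (#|F|%:R / 2)) : R^o)) ->
  \forall m \near \oo,
    (nclique (@adj (G m)) s)%:R <= g * Num.sqrt (m%:R : R) ^+ s.
Proof.
move=> s3 colF g0 sz lo.
have [c cP] := colorable_leq (leqnn s) colF.
have [c' [N0 [c'0 sup]]] := sparse_supersaturation s3 cP g0.
pose ff : R := (#|F| ^ #|F|)%N%:R.
have ff0 : 0 < ff by rewrite ltr0n expn_gt0; case: #|F|.
(* Half of the copy density that too many cliques would force; [ff] bounds the homomorphisms per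
   copy. *)
have e0 : 0 < c' / (2 * ff) by rewrite divr_gt0 // mulr_gt0.
move/eqoP: lo => /(_ _ e0) lo.
near=> m.
have m0 : (0 < m)%N by near: m; exact: nbhs_infty_gt.
pose N : R := Num.sqrt m%:R.
have N_gt0 : 0 < N by rewrite sqrtr_gt0 ltr0n.
have N2 : N ^+ 2 = m%:R by rewrite sqr_sqrtr.
have NN0 : N0 <= N.
  have [N00|N00] := lerP N0 0; first exact: le_trans N00 (ltW N_gt0).
  have : N0 ^+ 2 <= m%:R by near: m; exact: nbhs_infty_ger.
  by rewrite -N2 ler_pXn2r ?nnegrE // ltW.
rewrite leNgt; apply/negP => big.
have arcs : #|[set q : G m * G m | adj q.1 q.2]%SET|%:R <= 2 * N ^+ 2.
  by rewrite N2 -natrM ler_nat; have := card_arcs_le (G m); rewrite sz.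
have := sup _ _ N (@adj_sym (G m)) (@adj_irr (G m)) N_gt0 NN0 arcs (ltW big).
have : `|(num_copies F (G m))%:R : R^o| <= c' / (2 * ff) * `|(m%:R `^ (#|F|%:R / 2)) : R^o|.
  by near: m.
have -> : m%:R `^ (#|F|%:R / 2) = N ^+ #|F|.
  by rewrite mulrC powRrM powR12_sqrt // powR_mulrn // sqrtr_ge0.
have NF : 0 < N ^+ #|F| by rewrite exprn_gt0.
rewrite ger0_norm ?ler0n // ger0_norm ?(ltW NF) // => up low.
have := inj_homs_le_copies F (G m); rewrite -(ler_nat R) natrM -/ff => ih.
have : c' * N ^+ #|F| <= ff * (c' / (2 * ff) * N ^+ #|F|).
  by apply: (le_trans low); apply: (le_trans ih); rewrite ler_pM2l.
have -> : ff * (c' / (2 * ff) * N ^+ #|F|) = c' * N ^+ #|F| / 2.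
  by field; rewrite gt_eqF.
have := mulr_gt0 c'0 NF; lra.
Unshelve. all: by end_near.
Qed.

(** Translates [spectral_stability] to graphs with al = sqrt((1 - 1/r) / (2m)), so that al N <= 1
    for N = sqrt m. *)
Lemma spectral_multipartite (R : realType) (F : sgraph) (r : nat) (eps : R) :
  (2 <= r)%N -> colorable F r.+1 -> 0 < eps ->
  exists delta : R, 0 < delta /\
  forall G : nat -> sgraph,
    (forall m, size_graph (G m) = m) ->
    ((fun m => (num_copies F (G m))%:R : R^o) =o_\oo
       (fun m => (m%:R `^ (#|F|%:R / 2)) : R^o)) ->
    \forall m \near \oo,
      Num.sqrt ((1 - r%:R^-1 - delta) * (2 * m%:R)) <= rho R (G m) ->
      exists P : 'I_r -> {set G m},
        [/\ forall i j, i != j -> [disjoint P i & P j]%bool,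
            (3 <= r)%N -> forall i j, #|P i| = #|P j| &
            (gdist (graph_of (G m)) (complete_multipartite P))%:R <= eps * m%:R].
Proof.
move=> r2 colF eps0.
(* Dividing by al^2 = c / (2m) turns eps / 4 into eps m / (2c), at most eps m because c >= 1/2. *)
have e4 : 0 < eps / 4 by rewrite divr_gt0.
have [d [g [d0 g0 core]]] := spectral_stability r2 e4.
pose d' := Num.min d 2^-1.
have d'0 : 0 < d' by rewrite lt_min d0 invr_gt0 ltr0n.
have d'd : d' <= d by rewrite ge_min lexx.
have d'1 : d' <= 2^-1 by rewrite ge_min lexx orbT.
(* As c >= 1/2, d' / 4 < d' c: the assumed radius is strictly above the level [y] used below, as
   [rho_rayleigh] requires. *)
exists (d' / 4); split; first by rewrite divr_gt0.
move=> G sz lo.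
have i2 : r%:R^-1 <= 2^-1 :> R by rewrite lef_pV2 ?posrE ?ltr0n ?ler_nat // (leq_trans _ r2).
have i0 : 0 < r%:R^-1 :> R by rewrite invr_gt0 ltr0n (leq_trans _ r2).
pose c : R := 1 - r%:R^-1.
have c2 : 2^-1 <= c by rewrite /c; lra.
have c1 : c <= 1 by rewrite /c; lra.
have c0 : 0 < c by lra.
have few := few_cliques_of_few_copies (r2 : (3 <= r.+1)%N) colF g0 sz lo.
near=> m => rhoG.
have m0 : (0 < m)%N by near: m; exact: nbhs_infty_gt.
have mR : 0 < m%:R :> R by rewrite ltr0n.
pose N : R := Num.sqrt m%:R.
have N_gt0 : 0 < N by rewrite sqrtr_gt0.
have N2 : N ^+ 2 = m%:R by rewrite sqr_sqrtr.
pose al : R := Num.sqrt (c / (2 * m%:R)).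
have al0 : 0 < al by rewrite sqrtr_gt0 divr_gt0 // mulr_gt0.
have al2 : al ^+ 2 * (2 * m%:R) = c.
  by rewrite sqr_sqrtr ?divfK ?gt_eqF ?mulr_gt0 // ltW // divr_gt0 // mulr_gt0.
pose y := (1 - d') * c / al.
have y0 : 0 <= y by rewrite divr_ge0 ?(ltW al0) // mulr_ge0 ?(ltW c0) //; lra.
have yrho : y < rho R (G m).
  apply: lt_le_trans rhoG.
  rewrite -[ltLHS]ger0_norm // -sqrtr_sqr ltr_sqrt; last first.
    by rewrite mulr_gt0 ?mulr_gt0 // -/c; lra.
  have -> : 2 * m%:R = c / al ^+ 2 by rewrite -al2 [RHS]mulrC mulKf // gt_eqF // exprn_gt0.
  rewrite /y expr_div_n [ltRHS]mulrA ltr_pM2r ?invr_gt0 ?exprn_gt0 //.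
  rewrite exprMn expr2 -mulrA; rewrite [c ^+ 2]expr2.
  rewrite -/c; have : d' / 4 < d' * c by nra.
  move=> h; have h' : (1 - d') * c < c - d' / 4 by lra.
  have := ltr_pM2r c0 ((1 - d') * c) (c - d' / 4); rewrite h' => h2.
  apply: le_lt_trans h2; rewrite -[leRHS]mulrA.
  by rewrite ler_piMl ?mulr_ge0 ?(ltW c0) //; lra.
have [x [x0 x1 xray]] := rho_rayleigh y0 yrho.
have arcs : al ^+ 2 *+ #|[set q : G m * G m | adj q.1 q.2]%SET| <= 1 - r%:R^-1.
  rewrite -/c -al2 -mulr_natr ler_pM2l ?exprn_gt0 //.
  by rewrite -natrM ler_nat; have := card_arcs_le (G m); rewrite sz.
have ray : (1 - d) * (1 - r%:R^-1) <= al * \sum_(q : G m * G m | adj q.1 q.2) x q.1 * x q.2.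
  apply: (@le_trans _ _ ((1 - d') * c)); first by rewrite /c ler_wpM2r //; lra.
  have := ler_wpM2l (ltW al0) xray; rewrite /y mulrC divfK // gt_eqF //.
have alN : al * N <= 1.
  rewrite -(@ler_pXn2r _ 2) ?nnegrE ?mulr_ge0 ?(ltW al0) ?(ltW N_gt0) //.
  rewrite exprMn N2 expr1n; move: al2; lra.
have cl : (nclique (@adj (G m)) r.+1)%:R * al ^+ r.+1 <= g.
  have h : (nclique (@adj (G m)) r.+1)%:R <= g * N ^+ r.+1 by rewrite /N; near: m.
  apply: (le_trans (ler_wpM2r (exprn_ge0 r.+1 (ltW al0)) h)).
  rewrite -mulrA -exprMn ler_piMr ?(ltW g0) // mulrC exprn_ile1 //.
  by rewrite mulr_ge0 ?(ltW al0) ?(ltW N_gt0).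
have [P [disj eqc dist]] := core _ _ x al (@adj_sym (G m)) (@adj_irr (G m)) x0 x1 al0 arcs ray cl.
exists P; split=> //.
set D := (_ + _)%N in dist.
apply: (@le_trans _ _ D%:R); first by rewrite ler_nat gdist_le.
have A0 : 0 < al ^+ 2 by rewrite exprn_gt0.
rewrite -(ler_pM2l A0) [leLHS]mulr_natr; apply: (le_trans dist).
have -> : al ^+ 2 * (eps * m%:R) = eps / 2 * c by rewrite -al2; field.
by nra.
Unshelve. all: by end_near.
Qed.

Theorem theorem1p3 (R : realType) (F : sgraph) (f r : nat)
    (cardF : #|F| = f) (chiF : chi F = r.+1) (r_ge : (2 <= r.+1)%N) :
  forall eps : R, 0 < eps ->
  exists delta : R, 0 < delta /\
  forall G : nat -> sgraph,
    (forall m, size_graph (G m) = m) ->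
    ((fun m => (num_copies F (G m))%:R : R^o) =o_\oo
       (fun m => (m%:R `^ (f%:R / 2)) : R^o)) ->
    \forall m \near \oo,
      ((3 <= r)%N ->
       Num.sqrt ((1 - r%:R^-1 - delta) * (2 * m%:R)) <= rho R (G m) ->
       exists (n : nat) (T : graph_in (G m)),
         is_turan n r T /\
         (gdist (graph_of (G m)) T)%:R <= eps * m%:R)
      /\
      ((r = 2%N /\ Num.sqrt ((1 - delta) * m%:R) <= rho R (G m)) \/
       [/\ r = 1%N, (2 <= beta' F)%N
         & Num.sqrt ((1 - delta) * m%:R) <= rho R (G m)] ->
       exists U V : {set (G m)},
         [disjoint U & V]%bool /\
         (gdist (graph_of (G m)) (complete_bipartite U V))%:R
           <= eps * m%:R).
Proof.
move=> eps eps0; subst f.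
have colF : colorable F r.+1 by rewrite -chiF chi_colorable.
(* For r >= 3 the equal parts form a Turan graph on their union; r = 1 and r = 2 are treated
   together. *)
have [r3|r3] := leqP 3 r.
  have [delta [delta0 H]] := spectral_multipartite (ltnW r3) colF eps0.
  exists delta; split=> // G sz lo; have {}H := H G sz lo.
  near=> m; split; last by case=> [[E _]|[E _ _]]; rewrite E in r3.
  move=> _ hrho.
  have [P [disj eqc dist]] : exists P : 'I_r -> {set G m},
        [/\ forall i j, i != j -> [disjoint P i & P j]%bool,
            (3 <= r)%N -> forall i j, #|P i| = #|P j| &
            (gdist (graph_of (G m)) (complete_multipartite P))%:R <= eps * m%:R].
    by move: hrho; near: m.
  exists #|(complete_multipartite P).1|, (complete_multipartite P); split=> //.
  by split=> //; exists P; split=> // i j; rewrite (eqc r3 i j).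
(* Since r + 1 <= 3, the graph [F] is 3-colourable, and the bipartite case of stability applies to r
   = 1 as well. *)
have [c3 cP] : exists c : F -> 'I_3, forall u v, adj u v -> c u != c v.
  exact: colorable_leq colF.
have col3 : colorable F 3.
  apply/existsP; exists [ffun u => c3 u]; apply/forallP => u; apply/forallP => v.
  by apply/implyP => uv; rewrite !ffunE cP.
have [delta [delta0 H]] := spectral_multipartite (leqnn 2) col3 eps0.
exists delta; split=> // G sz lo; have {}H := H G sz lo.
near=> m; split=> // hyp.
have hrho : Num.sqrt ((1 - delta) * m%:R) <= rho R (G m) by case: hyp => [[_ ?]|[_ _ ?]].
(* (1/2 - delta) 2m = (1 - 2 delta) m, which is at most (1 - delta) m. *)
have {}hrho : Num.sqrt ((1 - 2%:R^-1 - delta) * (2 * m%:R)) <= rho R (G m).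
  apply: le_trans hrho; apply: ler_wsqrtr.
  have := mulr_ge0 (ltW delta0) (ler0n R m); lra.
have [P [disj _ dist]] : exists P : 'I_2 -> {set G m},
        [/\ forall i j, i != j -> [disjoint P i & P j]%bool,
            (3 <= 2)%N -> forall i j, #|P i| = #|P j| &
            (gdist (graph_of (G m)) (complete_multipartite P))%:R <= eps * m%:R].
  by move: hrho; near: m.
exists (P ord0), (P ord_max); split; first exact: disj.
by rewrite /gdist complete_bipartiteE.
Unshelve. all: by end_near.
Qed.
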